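(* Let the $2\times2$ twist matrix $K$ be diagonalizable, with simple spectrum, and invertible. Then for almost any choice of the co-vector $\langle\Omega|\in\mathcal H^*$ and of the inhomogeneities $\{\xi_1,\dots,\xi_N\}$ satisfying $\xi_i\neq\xi_j\bmod\eta$ for $i\ne j$, the set of co-vectors $${}_f\langle h_1,\dots,h_N|=\langle\Omega|\prod_{n=1}^N\big(\mathsf T^{(K|2s_n)}(\xi_n^{(2s_n-1)})\big)^{h_n},\qquad h_n\in\{0,\dots,2s_n\},\ n\in\{1,\dots,N\},$$ is a basis of $\mathcal H^*$. In particular, one can choose $\langle\Omega|=\bigotimes_{n=1}^N\langle\omega_n|$, where for each $n\in\{1,\dots,N\}$, $\langle\omega_n|$ is any local co-vector of $V_n$ such that the $2s_n+1$ co-vectors $\langle\omega_n|\,[K_n^{(2s_n)}]^{h_n}$, $h_n\in\{0,\dots,2s_n\}$, form a co-vector basis of $V_n$. Moreover, under the same conditions, the transfer matrix $\mathsf T^{(K)}(\lambda)$ is diagonalizable with simple spectrum.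
   Context: Setting. Let $\eta\in\mathbb{C}\setminus\{0\}$, $N\ge1$, and let $s_1,\dots,s_N$ be spins with $2s_n\in\mathbb{Z}_{>0}$. Let $V_n=\mathbb{C}^{2s_n+1}$ and $\mathcal H=\bigotimes_{n=1}^N V_n$. On $V_n$ let $S_n^z=\mathrm{diag}(s_n,s_n-1,\dots,-s_n)$, let $S_n^+$ be the matrix with only nonzero entries $(S_n^+)_{j,j+1}=\sqrt{j(2s_n+1-j)}$, $1\le j\le 2s_n$, and let $S_n^-=(S_n^+)^t$. With auxiliary space $V_0=\mathbb{C}^2$, the Lax operator is $$\mathsf L_{0n}(\lambda)=\begin{pmatrix}\lambda+\eta(\tfrac12+S_n^z)&\eta S_n^-\\ \eta S_n^+&\lambda+\eta(\tfrac12-S_n^z)\end{pmatrix}_{[0]}.$$ For a $2\times2$ twist matrix $K$ and inhomogeneities $\xi_1,\dots,\xi_N\in\mathbb{C}$, the monodromy matrix is $\mathsf M_0(\lambda)=K_0\mathsf L_{0N}(\lambda-\xi_N)\cdots\mathsf L_{01}(\lambda-\xi_1)$ and the transfer matrix is $\mathsf T^{(K)}(\lambda)=\mathsf T^{(K|1)}(\lambda)=\mathrm{tr}_0\mathsf M_0(\lambda)$. Fused transfer matrices. For $l\ge1$, let $P^+_{1\dots l}$ be the projector onto symmetric tensors in $(\mathbb{C}^2)^{\otimes l}$, with image $V^+_{1\dots l}$. Set $\mathsf T^{(K|l)}(\lambda)=\mathrm{tr}_{V^+_{1\dots l}}\big[P^+_{1\dots l}\mathsf M_1(\lambda+(l-1)\eta)\cdots\mathsf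 M_{l-1}(\lambda+\eta)\mathsf M_l(\lambda)P^+_{1\dots l}\big]$. All these operators commute with each other. Fused twist. $K_n^{(2s_n)}$ is the action of $K^{\otimes2s_n}$ on $\mathrm{Sym}^{2s_n}(\mathbb{C}^2)$, identified with $V_n$ as the spin-$s_n$ representation (the $j$-th basis vector of $V_n$ corresponds to the normalized symmetric tensor with $2s_n+1-j$ factors $e_1$ and $j-1$ factors $e_2$). Notation. $\xi_n^{(k)}=\xi_n-\tfrac\eta2+(s_n-k)\eta$. ''Almost any'' means outside the zero set of some nonzero polynomial in the components/parameters concerned. $\mathsf T^{(K)}(\lambda)$ ''diagonalizable with simple spectrum'' means the commuting family has a common eigenbasis with distinct eigenvalue functions of $\lambda$.
   Formalization: The first claim (basis for almost any Ω and ξ) additionally assumes that every fused twist K_n^{(2s_n)} has simple spectrum, i.e. that local co-vectors ω_n as described exist; without it the claim fails, e.g. for N=1, s_1=1, K=diag(1,-1). *)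

(* Defs.v *)
From HB Require Import structures.
From mathcomp Require Import all_boot all_order all_fingroup all_algebra.
From mathcomp Require Export complex reals mpoly.

Set Implicit Arguments.
Unset Strict Implicit.
Unset Printing Implicit Defensive.

Import Order.TTheory GRing.Theory Num.Theory.
Local Open Scope ring_scope.

(* Vectors are columns, co-vectors are rows, and operators act on co-vectors by
   right multiplication.  A spin s is encoded by the natural number l = 2s. *)

Section Generalities.
Variable C : numClosedFieldType.

Definition almost_all n (S : 'rV[C]_n -> Prop) : Prop :=
  exists p : {mpoly C[n]},
    p != 0 /\ forall x : 'rV[C]_n, p.@[x ord0] != 0 -> S x.

(* The family is indexed with multiplicity: a repeated co-vector is not free. *)
Definition is_cobasis (I : finType) m (v : I -> 'rV[C]_m) : Prop :=
  basis_of fullv [seq v i | i : I].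

Definition simple_spectrum n (A : 'M[C]_n) : Prop :=
  forall a : C, (\rank (eigenspace A a) <= 1)%N.

(* The columns of U form a common eigenbasis, with eigenvalue functions t i. *)
Definition diagonalizable_simple_family n (A : C -> 'M[C]_n) : Prop :=
  exists2 U : 'M[C]_n, U \in unitmx &
  exists t : 'I_n -> C -> C,
    (forall la, A la *m U = U *m diag_mx (\row_i t i la)) /\
    (forall i j, t i =1 t j -> i = j).

End Generalities.

Section Spin.
Variables (C : numClosedFieldType) (l : nat).

Definition spin_z : 'M[C]_l.+1 := diag_mx (\row_(j < l.+1) (l%:R / 2 - j%:R)).

(* With 1-based indices the (j, j+1) entry is sqrt (j (l + 1 - j)). *)
Definition spin_plus : 'M[C]_l.+1 :=
  \matrix_(i, j) if j == i.+1 :> nat then sqrtC (i.+1 * (l - i))%:R else 0.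

Definition spin_minus : 'M[C]_l.+1 := spin_plus^T.

End Spin.

Section SymmetricTensors.
Variables (C : numClosedFieldType) (l : nat).

(* Multi-indices of (C^2)^{(x) l}; the basis vectors e_1, e_2 of C^2 are
   indexed by 0, 1 : 'I_2. *)
Definition aux := {ffun 'I_l -> 'I_2}.

Definition aux_val (a : 'I_#|aux|) : aux := enum_val a.

Definition tensor_perm (s : 'S_l) : 'M[C]_#|aux| :=
  \matrix_(a, b) (aux_val b == [ffun k => aux_val a (s k)])%:R.

Definition symmetrizer : 'M[C]_#|aux| :=
  (l`!)%:R^-1 *: \sum_(s : 'S_l) tensor_perm s.

(* Column i is the normalized symmetric tensor with i factors e_2 and l - i
   factors e_1; the columns form an orthonormal basis of the image of
   symmetrizer. *)
Definition sym_basis : 'M[C]_(#|aux|, l.+1) :=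
  \matrix_(a, i)
    if #|[set k | aux_val a k == 1]| == i :> nat
    then (sqrtC 'C(l, i)%:R)^-1 else 0.

Definition tensor_power (K : 'M[C]_2) : 'M[C]_#|aux| :=
  \matrix_(a, b) \prod_(k < l) K (aux_val a k) (aux_val b k).

Definition fused_twist (K : 'M[C]_2) : 'M[C]_l.+1 :=
  sym_basis^T *m tensor_power K *m sym_basis.

End SymmetricTensors.

Section Chain.
Variables (C : numClosedFieldType) (N : nat) (l : 'I_N -> nat).

(* Indices of the canonical basis of H; this is also the set of tuples
   (h_1, ..., h_N) with 0 <= h_n <= 2 s_n. *)
Definition conf := {dffun forall n : 'I_N, 'I_(l n).+1}.

Definition hdim := #|conf|.

Definition conf_val (a : 'I_hdim) : conf := enum_val a.

Definition operator := 'M[C]_hdim.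

Definition local_op (n : 'I_N) (A : 'M[C]_((l n).+1)) : operator :=
  \matrix_(a, b)
    if [forall m, (m != n) ==> (conf_val a m == conf_val b m)]
    then A (conf_val a n) (conf_val b n) else 0.

Definition tensor_covector (w : forall n : 'I_N, 'rV[C]_((l n).+1)) :
    'rV[C]_hdim :=
  \row_a \prod_(n < N) w n ord0 (conf_val a n).

(* Operators on an auxiliary space (x) H are matrices with operator entries;
   this embeds X as X (x) id_H. *)
Definition lift_aux m p (X : 'M[C]_(m, p)) : 'M[operator]_(m, p) :=
  map_mx (fun c : C => c%:M : operator) X.

Variable eta : C.

Definition lax (n : 'I_N) (la : C) : 'M[operator]_2 :=
  \matrix_(i, j) local_op
    (if i == 0 then
       if j == 0 then la%:M + eta *: (2^-1%:M + spin_z C (l n))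
       else eta *: spin_minus C (l n)
     else
       if j == 0 then eta *: spin_plus C (l n)
       else la%:M + eta *: (2^-1%:M - spin_z C (l n))).

Variables (K : 'M[C]_2) (xi : 'rV[C]_N).

(* The site indices decrease from left to right, hence rev_ord. *)
Definition monodromy (la : C) : 'M[operator]_2 :=
  lift_aux K *m
  \prod_(i < N) lax (rev_ord i) (la - xi ord0 (rev_ord i)).

Definition transfer (la : C) : operator := \tr (monodromy la).

(* M_1(la + (q-1) eta) ... M_{q-1}(la + eta) M_q(la) on (C^2)^{(x) q} (x) H. *)
Definition monodromy_product (q : nat) (la : C) : 'M[operator]_#|aux q| :=
  \matrix_(a, b) \prod_(k < q)
    monodromy (la + (q - k.+1)%:R * eta) (aux_val a k) (aux_val b k).

Definition fused_transfer (q : nat) (la : C) : operator :=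
  let P := lift_aux (symmetrizer C q) in
  let E := lift_aux (sym_basis C q) in
  \tr (E^T *m (P *m monodromy_product q la *m P) *m E).

Definition shifted_xi (n : 'I_N) (k : nat) : C :=
  xi ord0 n - eta / 2 + ((l n)%:R / 2 - k%:R) * eta.

(* By commutativity, the order of the factors is immaterial. *)
Definition sov_covector (Omega : 'rV[C]_hdim) (h : conf) : 'rV[C]_hdim :=
  Omega *m
  \prod_(n < N) fused_transfer (l n) (shifted_xi n (l n).-1) ^+ h n.

Definition distinct_mod_eta : Prop :=
  forall i j : 'I_N, i != j ->
  forall z : int, xi ord0 i - xi ord0 j != z%:~R * eta.

End Chain.

(* Main.v *)
(* All covectors are compared in the limit where the inhomogeneities are sent to
   infinity and away from each other, xi_n = n / tau with tau -> 0.  There the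
   Lax operators of the sites m != n become scalar at spectral parameters near
   xi_n, so the fused transfer matrix of site n tends, up to a nonzero factor,
   to the fusion of the Lax operators of site n alone.  At the fusion point this
   is the permutation of Sym^(2s) and V_n times the twist, hence the limit is
   the local operator K_n^(2s): the covectors become tensor products of local
   bases.  The determinant of the family is polynomial in the inhomogeneities,
   so it is nonzero almost everywhere.

   Likewise T(xi_n) tends to an affine function of the action of K on V_n as an
   element of gl_2, which has simple spectrum when K has.  A suitable linear
   combination of the T(xi_n) has simple spectrum in the limit, hence almost
   everywhere, and by the RLL relations T(lambda) commutes with it. *)

Require Import Defs.
From HB Require Import structures.
From mathcomp Require Import all_boot all_order all_fingroup all_algebra.
From mathcomp Require Import complex reals ring zify separable.

Set Implicit Arguments.
Unset Strict Implicit.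
Unset Printing Implicit Defensive.

Import Order.TTheory GRing.Theory Num.Theory.
Local Open Scope ring_scope.

(** The fusion identity is checked on pure powers only. Contracted with x^l and y^l, the fused
    product becomes a product of l matrices, each affine in the action of the rank-one matrix y^T x
    on Sym^l. They share an eigenbasis, and the spectral shifts make their product vanish on all but
    one eigenvector. Polynomial density then gives the identity on all symmetric tensors. The point
    tau = 0 is not a value of the inhomogeneities, so nothing can be evaluated there directly. Once
    powers of 1/tau are factored out, all quantities are polynomial in tau; nonvanishing at 0 gives
    nonvanishing at some tau <> 0, the witness that a polynomial in the inhomogeneities is not zero.
    The two local limits differ. The eigenvalues kappa_0^(l-i) kappa_1^i of the fused twist may
    coincide when kappa_1/kappa_0 is a root of unity, hence the assumption on the fused twists in
    the first claim. Those of the limit of T(xi_n) are affine in i with slope proportional to eta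
    (kappa_1 - kappa_0), so they are always distinct. *)

(** * Pure powers and symmetric tensors over C^2 *)

Section SymmetricPower.
Variables (C : numClosedFieldType) (l : nat).
Implicit Types (x w : 'rV[C]_2) (K G : 'M[C]_2) (f : aux l).

Local Notation sqC i := (sqrtC ('C(l, i))%:R : C).

(** The pure power x^l in the coordinates of [sym_basis]: summing the binomially many equal entries
    of weight i, each divided by the square root of the binomial, leaves that square root. *)
Definition sym_row x : 'rV[C]_l.+1 :=
  \row_i (sqC i * x 0 0 ^+ (l - i) * x 0 1 ^+ i).

Definition tensor_row x : 'rV[C]_#|aux l| :=
  \row_a \prod_(k < l) x 0 (aux_val a k).

Lemma sqrtC_bin_neq0 (i : 'I_l.+1) : sqC i != 0.
Proof. by rewrite sqrtC_eq0 pnatr_eq0 -lt0n bin_gt0 -ltnS. Qed.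

Lemma sum_aux (V : nmodType) (F : aux l -> V) :
  \sum_(a < #|aux l|) F (aux_val a) = \sum_f F f.
Proof.
by rewrite [RHS](reindex _ (onW_bij _ (@enum_val_bij (aux l)))).
Qed.

Definition weight (f : aux l) := #|[set k | f k == 1]|.

Lemma weight_ltn f : (weight f < l.+1)%N.
Proof. by rewrite ltnS -[leqRHS]card_ord max_card. Qed.

Lemma prod_weight x f :
  \prod_(k < l) x 0 (f k) = x 0 0 ^+ (l - weight f) * x 0 1 ^+ weight f.
Proof.
rewrite (bigID (fun k => f k == 1)) /= mulrC.
rewrite (eq_bigr (fun=> x 0 0)); last first.
  by move=> k; case: (f k) => [[|[|]]] //= p _; congr (x 0 _); apply: val_inj.
rewrite [X in _ * X](eq_bigr (fun=> x 0 1)); last by move=> k /eqP ->.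
rewrite !prodr_const; congr (_ ^+ _ * _ ^+ _); last by rewrite /weight cardsE.
rewrite /weight -[X in (X - _)%N](card_ord l) -(cardC [set k | f k == 1]) addKn.
by apply: eq_card => k; rewrite !inE.
Qed.

Lemma card_weight (i : nat) : #|[pred f : aux l | weight f == i]| = 'C(l, i).
Proof.
rewrite -[in RHS](card_ord l) -card_draws.
pose h (f : aux l) := [set k | f k == 1].
pose g (A : {set 'I_l}) : aux l := [ffun k => if k \in A then 1 else 0].
have gK : cancel g h.
  by move=> A; apply/setP => k; rewrite !inE ffunE; case: ifP.
have hK : cancel h g.
  move=> f; apply/ffunP => k; rewrite ffunE inE.
  case: ifP => [/eqP ->//|]; case: (f k) => [[|[|]]] //= p _; exact: val_inj.
rewrite -(card_image (can_inj hK)) cardE cardE.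
apply/perm_size/uniq_perm; rewrite ?enum_uniq // => A.
rewrite !mem_enum [RHS]inE; apply/imageP/idP => [[f fi ->]|Ai]; first by [].
by exists (g A); rewrite ?gK // inE /weight -/(h _) gK.
Qed.

Lemma tensor_row_sym_basis x : tensor_row x *m sym_basis C l = sym_row x.
Proof.
apply/rowP => i; rewrite !mxE.
transitivity (\sum_(f : aux l | weight f == i)
   x 0 0 ^+ (l - i) * x 0 1 ^+ i * (sqC i)^-1).
  rewrite [RHS]big_mkcond /=; apply: etrans (sum_aux (fun f =>
    if weight f == i then x 0 0 ^+ (l - i) * x 0 1 ^+ i * (sqC i)^-1 else 0)).
  apply: eq_bigr => a _; rewrite !mxE prod_weight.
  by rewrite -/(weight _); case: eqP => [->//|_]; rewrite mulr0.
rewrite sumr_const card_weight -[LHS]mulr_natl.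
have := sqrtC_bin_neq0 i; rewrite -[X in X * _](sqrtCK 'C(l, i)%:R).
by move: (sqrtC _) => s s0; field.
Qed.

Lemma sym_row_sym_basis x : sym_row x *m (sym_basis C l)^T = tensor_row x.
Proof.
apply/rowP => a; rewrite !mxE prod_weight.
rewrite (bigD1 (Ordinal (weight_ltn (aux_val a)))) //= big1 => [|i ne].
  rewrite !mxE -/(weight _) eqxx addr0 mulrC !mulrA mulVf ?mul1r //.
  exact: (sqrtC_bin_neq0 (Ordinal (weight_ltn (aux_val a)))).
rewrite !mxE -/(weight _) ifN ?mulr0 //.
by apply: contraNneq ne => e; apply/eqP/val_inj.
Qed.

Lemma tensor_row_power x K :
  tensor_row x *m tensor_power l K = tensor_row (x *m K).
Proof.
apply/rowP => b; rewrite !mxE.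
under [RHS]eq_bigr do rewrite mxE.
rewrite bigA_distr_bigA /=.
apply: etrans (sum_aux (fun f : aux l => \prod_k (x 0 (f k) * K (f k) (aux_val b k)))).
apply: eq_bigr => a _.
by rewrite !mxE -big_split.
Qed.

Lemma sym_row_fused_twist x K :
  sym_row x *m fused_twist l K = sym_row (x *m K).
Proof.
by rewrite /fused_twist !mulmxA sym_row_sym_basis tensor_row_power
  tensor_row_sym_basis.
Qed.

Lemma tensor_row_perm x (s : 'S_l) :
  tensor_row x *m tensor_perm C s = tensor_row x.
Proof.
apply/rowP => b; rewrite !mxE.
pose f : aux l := [ffun k => aux_val b ((s^-1)%g k)].
transitivity (\sum_(g | g == f) \prod_k x 0 (g k)).
  rewrite [RHS]big_mkcond /=;
  apply: etrans (sum_aux (fun g => if g == f then \prod_k x 0 (g k) else 0)).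
  apply: eq_bigr => a _; rewrite !mxE.
  have -> : (aux_val b == [ffun k => aux_val a (s k)]) = (aux_val a == f).
    apply/eqP/eqP => [e|->]; apply/ffunP => k; rewrite !ffunE ?permK //.
    by rewrite e ffunE permKV.
  by case: eqP; rewrite ?mulr1 ?mulr0.
rewrite big_pred1_eq (reindex_inj (@perm_inj _ s)) /=.
by apply: eq_bigr => k _; rewrite ffunE permK.
Qed.

Lemma tensor_row_symmetrizer x : tensor_row x *m symmetrizer C l = tensor_row x.
Proof.
rewrite -scalemxAr mulmx_sumr (eq_bigr _ (fun (s : 'S_l) _ => tensor_row_perm x s)).
rewrite sumr_const card_Sn -scaler_nat scalerA mulVf ?scale1r //.
by rewrite pnatr_eq0 -lt0n fact_gt0.
Qed.

Lemma tr_symmetrizer : (symmetrizer C l)^T = symmetrizer C l.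
Proof.
rewrite linearZ /=; congr (_ *: _); rewrite linear_sum (reindex_inj invg_inj) /=.
apply: eq_bigr => s _; apply/matrixP => a b; rewrite !mxE; congr (nat_of_bool _)%:R.
by apply/eqP/eqP => ->; apply/ffunP => k; rewrite !ffunE ?permK ?permKV.
Qed.

Definition affine_row (z : C) : 'rV[C]_2 := \row_j (if j == 0 then 1 else z).

(* The polynomial g excludes finitely many z: below, the rank-one formula at the
   fusion point is only available for x . y != 0. *)
Lemma sym_row_separates m (A : 'M[C]_(l.+1, m)) (g : {poly C}) : g != 0 ->
  (forall z, g.[z] != 0 -> sym_row (affine_row z) *m A = 0) -> A = 0.
Proof.
move=> g0 h; apply/matrixP => i j; rewrite mxE.
(* Along affine rows [sym_row] is a weighted moment curve, so column j of [A] becomes the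
   coefficients of a polynomial. *)
pose p := \poly_(k < l.+1) (sqC k * A (inord k) j).
have pE z : p.[z] = (sym_row (affine_row z) *m A) 0 j.
  rewrite horner_poly mxE; apply: eq_bigr => k _.
  by rewrite !mxE /= expr1n mulr1 inord_val mulrAC.
have : p * g = 0.
  apply/eqP/negPn/closed_nonrootP => -[z].
  rewrite rootM /root negb_or => /andP[pz /h e]; move: pz.
  by rewrite pE e mxE eqxx.
move/eqP; rewrite mulf_eq0 (negPf g0) orbF => /eqP p0.
have := coef_poly l.+1 (fun k => sqC k * A (inord k) j) i.
rewrite -/p p0 coef0 ltn_ord inord_val => /esym/eqP.
by rewrite mulf_eq0 (negPf (sqrtC_bin_neq0 i)) => /eqP.
Qed.
End SymmetricPower.

(** * Group and Lie algebra actions on Sym^l *)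

Section FusedTwist.
Variables (C : numClosedFieldType) (l : nat).
Implicit Types (x y w : 'rV[C]_2) (K G : 'M[C]_2).

Local Notation sqC i := (sqrtC ('C(l, i))%:R : C).

(** Pure powers span the symmetric power, so they suffice to compare matrices acting on it. *)
Lemma sym_row_inj m (A B : 'M[C]_(l.+1, m)) :
  (forall x, sym_row l x *m A = sym_row l x *m B) -> A = B.
Proof.
move=> h; apply/eqP; rewrite -subr_eq0; apply/eqP.
apply: (sym_row_separates (oner_neq0 _)) => z _.
by rewrite mulmxBr h subrr.
Qed.

Lemma fused_twistM K G : fused_twist l (K *m G) = fused_twist l K *m fused_twist l G.
Proof. by apply: sym_row_inj => x; rewrite mulmxA !sym_row_fused_twist mulmxA. Qed.

Lemma fused_twist1 : fused_twist l 1%:M = 1%:M :> 'M[C]_l.+1.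
Proof. by apply: sym_row_inj => x; rewrite sym_row_fused_twist !mulmx1. Qed.

Lemma fused_twist_unit G : G \in unitmx -> fused_twist l G \in unitmx.
Proof.
move=> uG; have := fused_twistM G (invmx G).
by rewrite mulmxV // fused_twist1 => /esym/mulmx1_unit[].
Qed.

Lemma tr_fused_twist G : (fused_twist l G)^T = fused_twist l G^T.
Proof.
rewrite !trmx_mul trmxK mulmxA; congr (_ *m _ *m _).
by apply/matrixP => a b; rewrite !mxE; apply: eq_bigr => k _; rewrite mxE.
Qed.

Lemma row2_mul_diag x (d : 'rV[C]_2) :
  x *m diag_mx d = \row_j (x 0 j * d 0 j).
Proof.
apply/rowP => j; rewrite !mxE (bigD1 j) //= big1 => [|i ij].
  by rewrite !mxE eqxx mulr1n addr0.
by rewrite !mxE (negPf ij) mulr0n mulr0.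
Qed.

Lemma fused_twist_diag (d : 'rV[C]_2) :
  fused_twist l (diag_mx d) = diag_mx (\row_i (d 0 0 ^+ (l - i) * d 0 1 ^+ i)).
Proof.
apply: sym_row_inj => x; rewrite sym_row_fused_twist row2_mul_diag.
apply/rowP => j; rewrite [RHS]mxE (bigD1 j) //= big1 => [|i ij].
  by rewrite !mxE eqxx mulr1n addr0 !exprMn; ring.
by rewrite !mxE (negPf ij) mulr0n mulr0.
Qed.

(** The derivative of [sym_row] at x in the direction w. Where a truncated exponent is wrong, its
    factor [(l - j)%:R] or [j%:R] is zero. *)
Definition sym_der x w : 'rV[C]_l.+1 :=
  \row_j (sqC j * (x 0 0 ^+ (l - j).-1 * (l - j)%:R * w 0 0 * x 0 1 ^+ j
                   + x 0 0 ^+ (l - j) * x 0 1 ^+ j.-1 * j%:R * w 0 1)).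

Definition sym_line x w (j : 'I_l.+1) : {poly C} :=
  (sqC j)%:P * ((x 0 0)%:P + (w 0 0) *: 'X) ^+ (l - j)
             * ((x 0 1)%:P + (w 0 1) *: 'X) ^+ j.

Lemma horner_sym_line x w j e :
  (sym_line x w j).[e] = sym_row l (x + e *: w) 0 j.
Proof.
rewrite /sym_line !hornerE /= !mxE.
by rewrite ![_ * e]mulrC.
Qed.

Lemma deriv_sym_line x w j : (sym_line x w j)^`().[0] = sym_der x w 0 j.
Proof.
rewrite /sym_line !derivM !derivC !mul0r !add0r !deriv_exp !derivD !derivC.
rewrite !derivZ !derivX !hornerE /= !hornerMn !hornerE /= !mxE.
rewrite -[(w 0 0 * _) *+ _]mulr_natr -[(w 0 1 * _) *+ _]mulr_natr.
move: (l - j)%:R (nat_of_ord j)%:R => a b.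
by move: (_ ^+ _) (_ ^+ _) (_ ^+ _) (_ ^+ _) => *; ring.
Qed.

(** [fused_twist l G] maps the curve of powers through x along w to the one through xG along wG;
    both are polynomial in the curve parameter, and the identity is differentiated at 0. *)
Lemma sym_der_fused_twist x w G :
  sym_der x w *m fused_twist l G = sym_der (x *m G) (w *m G).
Proof.
apply/rowP => j; rewrite mxE -deriv_sym_line.
have -> : sym_line (x *m G) (w *m G) j
          = \sum_i fused_twist l G i j *: sym_line x w i.
  apply/eqP; rewrite -subr_eq0; apply/negPn/closed_nonrootP => -[e /negP[]].
  rewrite rootE hornerD hornerN horner_sum horner_sym_line.
  rewrite scalemxAl -mulmxDl -sym_row_fused_twist mxE subr_eq0.
  by apply/eqP/eq_bigr => i _; rewrite hornerZ horner_sym_line mulrC.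
rewrite raddf_sum horner_sum; apply: eq_bigr => i _ /=.
by rewrite derivZ hornerZ deriv_sym_line mulrC.
Qed.

(** The action of gl_2 on Sym^l, that is, the derivative of [fused_twist] at the identity; the
    shifts by l/2 make the identity of gl_2 act by l. *)
Definition spin_rep K : 'M[C]_l.+1 :=
  K 0 0 *: ((l%:R / 2)%:M + spin_z C l) + K 0 1 *: spin_plus C l
  + K 1 0 *: spin_minus C l + K 1 1 *: ((l%:R / 2)%:M - spin_z C l).

Lemma sym_row_spin_z x c :
  sym_row l x *m (c%:M + spin_z C l)
  = \row_j (sym_row l x 0 j * (c + (l%:R / 2 - j%:R))).
Proof.
rewrite mulmxDr; apply/rowP => j; rewrite [LHS]mxE mul_mx_scalar.
rewrite [X in _ + X]mxE (bigD1 j) //= big1 => [|i ij].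
  by rewrite !mxE eqxx mulr1n addr0; ring.
by rewrite !mxE (negPf ij) mulr0n mulr0.
Qed.

(** The square roots in [spin_plus] are those required by the normalization of [sym_basis]. Both
    sides are nonnegative, so it suffices to compare squares. *)
Lemma sqC_succ i : (i < l)%N -> sqC i * sqrtC (i.+1 * (l - i))%:R = i.+1%:R * sqC i.+1.
Proof.
move=> il; have : sqC i * sqrtC (i.+1 * (l - i))%:R \is Num.nneg.
  by rewrite nnegrE mulr_ge0 // sqrtC_ge0 ler0n.
move=> h1.
have h2 : i.+1%:R * sqC i.+1 \is Num.nneg.
  by rewrite nnegrE mulr_ge0 // ?sqrtC_ge0 ler0n.
apply: (pexpIrn (isT : (0 < 2)%N) h1 h2).
rewrite !exprMn !sqrtCK -natrX -!natrM; congr _%:R.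
by rewrite -mulnn -mulnA mul_bin_left mulnC -mulnA.
Qed.

Lemma sym_row_spin_plus x :
  sym_row l x *m spin_plus C l
  = \row_j (sqC j * j%:R * x 0 0 ^+ (l - j).+1 * x 0 1 ^+ j.-1).
Proof.
apply/rowP => j; rewrite !mxE.
case: j => [[|j] jl] /=.
  by rewrite big1 ?mulr0 ?mul0r // => i _; rewrite !mxE mulr0.
have jl' := ltnW jl.
rewrite (bigD1 (Ordinal jl')) //= big1 => [|i ij]; last first.
  rewrite !mxE /= eqSS ifN ?mulr0 //.
  by apply: contraNneq ij => eij; apply/eqP/val_inj.
rewrite !mxE /= eqxx addr0 subnSK // [sqC j.+1 * _]mulrC -sqC_succ //; ring.
Qed.

Lemma sym_row_spin_minus x :
  sym_row l x *m spin_minus C l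
  = \row_j (sqC j * (l - j)%:R * x 0 0 ^+ (l - j).-1 * x 0 1 ^+ j.+1).
Proof.
apply/rowP => j; rewrite !mxE.
have [jl|lj] := ltnP j l; last first.
  have -> : (l - j)%N = 0%N by lia.
  rewrite big1 ?mulr0 ?mul0r // => i _; rewrite !mxE ifN ?mulr0 //.
  by have := ltn_ord i; lia.
have jl' : (j.+1 < l.+1)%N by [].
rewrite (bigD1 (Ordinal jl')) //= big1 => [|i ij]; last first.
  rewrite !mxE /= ifN ?mulr0 //.
rewrite !mxE /= eqxx addr0 -subnS.
have -> : sqC j.+1 * x 0 0 ^+ (l - j.+1) * x 0 1 ^+ j.+1 * sqrtC (j.+1 * (l - j))%:R
  = x 0 0 ^+ (l - j.+1) * x 0 1 ^+ j.+1 * (sqC j.+1 * sqrtC (j.+1 * (l - j))%:R) by ring.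
suff -> : sqC j.+1 * sqrtC (j.+1 * (l - j))%:R = sqC j * (l - j)%:R by ring.
have h1 : sqC j.+1 * sqrtC (j.+1 * (l - j))%:R \is Num.nneg.
  by rewrite nnegrE mulr_ge0 // sqrtC_ge0 ler0n.
have h2 : sqC j * (l - j)%:R \is Num.nneg.
  by rewrite nnegrE mulr_ge0 // ?sqrtC_ge0 ler0n.
apply: (pexpIrn (isT : (0 < 2)%N) h1 h2).
rewrite !exprMn !sqrtCK -natrX -!natrM; congr _%:R.
by rewrite mulnA [X in (X * _)%N]mulnC mul_bin_left -mulnn mulnA [X in (X * _)%N]mulnC.
Qed.

(** The infinitesimal form of [sym_row_fused_twist]: moving x to x + e xK differentiates x^l in the
    direction xK. *)
Lemma sym_row_spin_rep x K :
  sym_row l x *m spin_rep K = sym_der x (x *m K).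
Proof.
rewrite /spin_rep !mulmxDr -!scalemxAr sym_row_spin_z sym_row_spin_plus.
rewrite sym_row_spin_minus mulmxBr mul_mx_scalar.
have := sym_row_spin_z x 0; rewrite raddf0 add0r => ->.
apply/rowP => j; rewrite !mxE !big_ord_recl !big_ord0 /= !addr0.
have -> : lift ord0 ord0 = 1 :> 'I_2 by apply: val_inj.
have lj : (j <= l)%N by rewrite -ltnS.
have -> : x 0 0 ^+ (l - j).+1 = x 0 0 ^+ (l - j) * x 0 0 by rewrite exprSr.
have -> : x 0 1 ^+ j.+1 = x 0 1 ^+ j * x 0 1 by rewrite exprSr.
have e0 : x 0 0 ^+ (l - j) * (l - j)%:R = x 0 0 ^+ (l - j).-1 * x 0 0 * (l - j)%:R.
  by case: (l - j)%N => [|k]; rewrite ?mulr0 //= exprSr.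
have e1 : x 0 1 ^+ j * j%:R = x 0 1 ^+ j.-1 * x 0 1 * j%:R.
  by case: (nat_of_ord j) => [|k]; rewrite ?mulr0 //= exprSr.
have ->: K 0 0 * (sqC j * x 0 0 ^+ (l - j) * x 0 1 ^+ j * (l%:R / 2 + (l%:R / 2 - j%:R)))
  = K 0 0 * (sqC j * (x 0 0 ^+ (l - j) * (l - j)%:R) * x 0 1 ^+ j).
  by rewrite natrB //; field.
have ->: l%:R / 2 * (sqC j * x 0 0 ^+ (l - j) * x 0 1 ^+ j) -
   sqC j * x 0 0 ^+ (l - j) * x 0 1 ^+ j * (0 + (l%:R / 2 - j%:R))
  = sqC j * x 0 0 ^+ (l - j) * (x 0 1 ^+ j * j%:R) by field.
rewrite e0 e1; move: (l - j)%:R (nat_of_ord j)%:R => a b.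
by move: (_ ^+ (l - j)) (_ ^+ (l - j).-1) (_ ^+ j) (_ ^+ j.-1) => *; ring.
Qed.

(** Both sides send x^l to the derivative of the power at xG along xKG = xGD. This carries a
    diagonalization of [K] over to [spin_rep]. *)
Lemma spin_rep_fused_twist K G D : K *m G = G *m D ->
  spin_rep K *m fused_twist l G = fused_twist l G *m spin_rep D.
Proof.
move=> KG; apply: sym_row_inj => x.
rewrite mulmxA sym_row_spin_rep sym_der_fused_twist.
rewrite [RHS]mulmxA sym_row_fused_twist sym_row_spin_rep -!mulmxA KG //.
Qed.

Lemma spin_rep_diag (d : 'rV[C]_2) :
  spin_rep (diag_mx d) = diag_mx (\row_(i < l.+1) (d 0 0 * (l - i)%:R + d 0 1 * i%:R)).
Proof.
apply/matrixP => i j; rewrite !mxE /= ?mulr0n ?mulr1n ?mul0r ?addr0.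
have lj : (j <= l)%N by rewrite -ltnS.
case: (altP (i =P j)) => [->|_]; rewrite ?mulr1n ?mulr0n; last by ring.
by rewrite natrB //; field.
Qed.
End FusedTwist.

(** * Lax operators of a single site and their product at the fusion point *)

Section SiteLax.
Variables (C : numClosedFieldType) (l : nat) (eta : C).
Implicit Types (x y : 'rV[C]_2) (K G : 'M[C]_2).

Definition site_lax (la : C) (i j : 'I_2) : 'M[C]_l.+1 :=
  if i == 0 then
    if j == 0 then la%:M + eta *: (2^-1%:M + spin_z C l)
    else eta *: spin_minus C l
  else
    if j == 0 then eta *: spin_plus C l
    else la%:M + eta *: (2^-1%:M - spin_z C l).

Definition dot2 x y : C := x 0 0 * y 0 0 + x 0 1 * y 0 1.

Lemma sum_ord2 (V : nmodType) (F : 'I_2 -> V) : \sum_i F i = F 0 + F 1.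
Proof.
rewrite !big_ord_recl big_ord0 addr0; congr (_ + F _).
exact: val_inj.
Qed.

Lemma sum_ord2_2 (V : nmodType) (F : 'I_2 -> 'I_2 -> V) :
  \sum_i \sum_j F i j = F 0 0 + F 0 1 + (F 1 0 + F 1 1).
Proof. by rewrite !sum_ord2. Qed.

(** The Lax operator has eta/2 where [spin_rep] has eta l/2; the scalar term accounts for the
    difference. *)
Lemma trace_site_lax K la :
  \sum_p \sum_q K q p *: site_lax la p q =
  ((la + eta / 2 - eta * l%:R / 2) * \tr K)%:M + eta *: spin_rep l K.
Proof.
rewrite sum_ord2_2 /mxtrace sum_ord2 /site_lax /spin_rep /=.
apply/matrixP => i j; rewrite !mxE.
move: (if _ then _ else _) (if _ then _ else _) => a b.
by case: (i == j); rewrite ?mulr1n ?mulr0n; field.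
Qed.

Lemma contract_site_lax x y la :
  \sum_p \sum_q (x 0 p * y 0 q) *: site_lax la p q =
  ((la + eta / 2 - eta * l%:R / 2) * dot2 x y)%:M + eta *: spin_rep l (y^T *m x).
Proof.
have <- : \tr (y^T *m x) = dot2 x y by rewrite mxtrace_mulC trace_mx11 mxE sum_ord2 !mxE.
rewrite -trace_site_lax.
by apply: eq_bigr => p _; apply: eq_bigr => q _; rewrite !mxE big_ord1 mxE mulrC.
Qed.

(** The columns are eigenvectors of the rank-one matrix y^T x: first y^T, with eigenvalue x.y, then
    a vector annihilated by x. The determinant is -x.y. *)
Definition frame x y : 'M[C]_2 :=
  \matrix_(i, j) if j == 0 then y 0 i else if i == 0 then x 0 1 else - x 0 0.

Definition dot_diag x y : 'rV[C]_2 := \row_j (if j == 0 then dot2 x y else 0).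

Lemma mul_row_frame x y : x *m frame x y = dot_diag x y.
Proof.
apply/rowP => j; rewrite !mxE sum_ord2 !mxE /=.
by case: ifP => // _; rewrite mulrN mulrC subrr.
Qed.

Lemma frame_diag x y :
  (y^T *m x) *m frame x y = frame x y *m diag_mx (dot_diag x y).
Proof.
apply/matrixP => i j; rewrite -mulmxA mul_row_frame mxE big_ord1 !mxE.
rewrite sum_ord2 !mxE /=; case: j => [[|[|]]] //= p.
  by rewrite mulr1n mulr0n mulr0 addr0.
by rewrite ?mulr0n ?mulr1n; ring.
Qed.

Lemma frame_unit x y : dot2 x y != 0 -> frame x y \in unitmx.
Proof.
move=> xy; rewrite unitmxE unitfE (expand_det_row _ 0) sum_ord2 /cofactor.
rewrite !det_mx11 !mxE /= expr0 expr1 mul1r.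
apply: contraNneq xy => e; rewrite /dot2 -oppr_eq0 -e; apply/eqP.
have -> : lift 0 0 = 1 :> 'I_2 by exact: val_inj.
ring.
Qed.

Lemma mul_diag_mx_prod n q (U : 'M[C]_n) (A : 'I_q -> 'M[C]_n) (d : 'I_q -> 'rV[C]_n) :
  (forall k, A k *m U = U *m diag_mx (d k)) ->
  (\prod_k A k) *m U = U *m diag_mx (\row_i \prod_k d k 0 i).
Proof.
elim: q A d => [|q IH] A d h.
  rewrite big_ord0 mul1mx -[LHS]mulmx1; congr (_ *m _).
  by apply/matrixP => i j; rewrite !mxE big_ord0.
rewrite big_ord_recl -[_ * _]/(_ *m _) -mulmxA (IH _ (fun k => d (lift ord0 k))) //.
rewrite mulmxA h -mulmxA mulmx_diag; congr (_ *m diag_mx _).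
by apply/rowP => i; rewrite !mxE big_ord_recl.
Qed.

(* At the fusion point the Lax operators contracted with x and y share an
   eigenbasis on which their product vanishes but for one vector. *)
Lemma prod_contract_site_lax x y : dot2 x y != 0 ->
  \prod_(k < l) (\sum_p \sum_q (x 0 p * y 0 q) *:
    site_lax (eta * (l%:R / 2 - 2^-1 - k%:R)) p q)
  = (l`!%:R * eta ^+ l) *: ((sym_row l y)^T *m sym_row l x).
Proof.
move=> xy; pose G := frame x y.
have uG : fused_twist l G \in unitmx by rewrite fused_twist_unit ?frame_unit.
apply: (can_inj (mulmxK uG)).
(* At these spectral parameters the scalar part is -k eta (x.y), so the i-th eigenvalue of the k-th
   factor is eta (x.y) (l - i - k). The factor k = l - i kills every i > 0, while i = 0 leaves l!
   (eta x.y)^l. *)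
rewrite (mul_diag_mx_prod (d := fun k : 'I_l =>
  \row_(i < l.+1) (eta * dot2 x y * ((l - i)%:R - k%:R)))); last first.
  move=> k; rewrite contract_site_lax mulmxDl mul_scalar_mx -scalemxAl.
  rewrite (spin_rep_fused_twist l (frame_diag x y)) spin_rep_diag -mul_mx_scalar.
  rewrite scalemxAr -mulmxDr; congr (_ *m _).
  apply/matrixP => i j; rewrite !mxE /=.
  by case: (i == j); rewrite ?mulr1n ?mulr0n; field.
rewrite -scalemxAl -[in RHS]mulmxA sym_row_fused_twist mul_row_frame.
(* As y is the first column of [G], it equals e0 G^T, and y^l is reached from the power of e0 by the
   transposed action. *)
pose e0 : 'rV[C]_2 := \row_j (j == 0)%:R.
have -> : sym_row l y = sym_row l e0 *m (fused_twist l G)^T.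
  rewrite tr_fused_twist sym_row_fused_twist; congr (sym_row l _).
  by apply/rowP => j; rewrite !mxE sum_ord2 !mxE /= mul1r mul0r addr0.
rewrite trmx_mul trmxK -[in RHS]mulmxA [RHS]scalemxAr; congr (_ *m _).
apply/matrixP => i j; rewrite !mxE big_ord1 !mxE /=.
case: i => [[|i] il] /=; last first.
  rewrite [0 ^+ _]expr0n /= mulr0 mul0r mulr0.
  have il' : (l - i.+1 < l)%N by lia.
  rewrite (bigD1 (Ordinal il')) //=.
  by rewrite mxE subrr mulr0 mul0r mul0rn.
rewrite bin0 sqrtC1 expr0 subn0 expr1n !mul1r; case: j => [[|j] jl] /=; last first.
  by rewrite mulr0n expr0n /= !mulr0.
rewrite mulr1n bin0 sqrtC1 subn0 mul1r expr0 mulr1.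
under eq_bigr do rewrite mxE subn0.
rewrite big_split /=.
rewrite prodr_const card_ord exprMn.
have -> : \prod_(k < l) (l%:R - k%:R : C) = l`!%:R.
  rewrite fact_prod natr_prod big_add1 /= big_mkord (reindex_inj rev_ord_inj) /=.
  apply: eq_bigr => k _; have kl := ltn_ord k.
  by rewrite -natrB; [congr _%:R|]; rewrite /=; lia.
ring.
Qed.
End SiteLax.

Lemma prodZ_mx (C : fieldType) d n (c : 'I_n -> C) (A : 'I_n -> 'M[C]_d) :
  \prod_k (c k *: A k) = (\prod_k c k) *: \prod_k A k.
Proof.
elim: n c A => [|n IH] c A; first by rewrite !big_ord0 scale1r.
by rewrite !big_ord_recl IH -!mulmxE -scalemxAl -scalemxAr scalerA.
Qed.

(** * Fusion of arbitrary operator-valued 2x2 matrices *)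

Section FusedTrace.
Variables (C : numClosedFieldType) (q : nat).
Implicit Types (d : nat) (x y : 'rV[C]_2).

Definition scalar_entries d m p (X : 'M[C]_(m, p)) : 'M['M[C]_d]_(m, p) :=
  map_mx (fun c : C => c%:M : 'M[C]_d) X.

Definition fused_prod d (M : 'I_q -> 'I_2 -> 'I_2 -> 'M[C]_d) : 'M['M[C]_d]_#|aux q| :=
  \matrix_(a, b) \prod_(k < q) M k (aux_val a k) (aux_val b k).

(** Fusion before the final trace and for arbitrary factors, so that the same statements serve the
    whole chain, a single site and the rescaled monodromies. *)
Definition fused_mx d (M : 'I_q -> 'I_2 -> 'I_2 -> 'M[C]_d) : 'M['M[C]_d]_q.+1 :=
  let P := scalar_entries d (symmetrizer C q) in
  let E := scalar_entries d (sym_basis C q) in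
  E^T *m (P *m fused_prod M *m P) *m E.

Definition fusion_row : 'M[C]_(q.+1, #|aux q|) :=
  (sym_basis C q)^T *m symmetrizer C q.

Lemma scalar_entriesM d m n p (A : 'M[C]_(m, n)) (B : 'M[C]_(n, p)) :
  scalar_entries d (A *m B) = scalar_entries d A *m scalar_entries d B.
Proof.
apply/matrixP => i j; rewrite !mxE raddf_sum; apply: eq_bigr => k _.
by rewrite !mxE; exact: scalar_mxM.
Qed.

Lemma fused_mxE d (M : 'I_q -> 'I_2 -> 'I_2 -> 'M[C]_d) i j :
  fused_mx M i j = \sum_a \sum_b (fusion_row i a * fusion_row j b) *:
    \prod_(k < q) M k (aux_val a k) (aux_val b k).
Proof.
rewrite /fused_mx !mulmxA -mulmxA.
have -> : (scalar_entries d (sym_basis C q))^T *m scalar_entries d (symmetrizer C q)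
  = scalar_entries d fusion_row.
  by rewrite scalar_entriesM; congr (_ *m _); rewrite /scalar_entries map_trmx.
rewrite -scalar_entriesM.
have -> : symmetrizer C q *m sym_basis C q = fusion_row^T.
  by rewrite trmx_mul trmxK tr_symmetrizer.
rewrite mxE exchange_big; apply: eq_bigr => b _.
rewrite mxE big_distrl /=; apply: eq_bigr => a _; rewrite !mxE.
by rewrite -!mulmxE mul_scalar_mx mul_mx_scalar scalerA mulrC.
Qed.

Lemma sym_row_fusion_row x : sym_row q x *m fusion_row = tensor_row q x.
Proof. by rewrite mulmxA sym_row_sym_basis tensor_row_symmetrizer. Qed.

(** Symmetrization fixes pure tensors, so contracting with x^q and y^q makes the auxiliary indices
    independent, and the sum over multi-indices factorizes. *)
Lemma contract_fused_mx d (M : 'I_q -> 'I_2 -> 'I_2 -> 'M[C]_d) x y :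
  \sum_i \sum_j (sym_row q x 0 i * sym_row q y 0 j) *: fused_mx M i j
  = \prod_(k < q) \sum_p \sum_r (x 0 p * y 0 r) *: M k p r.
Proof.
transitivity (\sum_a \sum_b (tensor_row q x 0 a * tensor_row q y 0 b) *:
    \prod_(k < q) M k (aux_val a k) (aux_val b k)).
  under eq_bigr do under eq_bigr do rewrite fused_mxE scaler_sumr.
  under eq_bigr do rewrite exchange_big.
  rewrite exchange_big; apply: eq_bigr => a _ /=.
  under eq_bigr do under eq_bigr do rewrite scaler_sumr.
  under eq_bigr do rewrite exchange_big.
  rewrite exchange_big; apply: eq_bigr => b _ /=.
  rewrite -!sym_row_fusion_row !mxE big_distrlr scaler_suml /=.
  apply: eq_bigr => i _; rewrite scaler_suml; apply: eq_bigr => j _.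
  by rewrite scalerA; congr (_ *: _); ring.
under [RHS]eq_bigr do rewrite pair_bigA.
rewrite bigA_distr_bigA /=.
pose F (f g : aux q) : 'M[C]_d := \prod_(k < q) ((x 0 (f k) * y 0 (g k)) *: M k (f k) (g k)).
transitivity (\sum_f \sum_g F f g).
  rewrite -sum_aux; apply: eq_bigr => a _; rewrite -sum_aux; apply: eq_bigr => b _.
  rewrite !mxE -big_split /= /F.
  by rewrite prodZ_mx.
rewrite pair_bigA /=.
pose h (fg : aux q * aux q) : {ffun 'I_q -> 'I_2 * 'I_2} := [ffun k => (fg.1 k, fg.2 k)].
pose h' (f : {ffun 'I_q -> 'I_2 * 'I_2}) : aux q * aux q :=
  ([ffun k => (f k).1], [ffun k => (f k).2]).
have hb : bijective h.
  exists h' => [[f g]|f]; last by apply/ffunP => k; rewrite !ffunE -surjective_pairing.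
  by congr (_, _); apply/ffunP => k; rewrite !ffunE.
rewrite [RHS](reindex h (onW_bij _ hb)) /=; apply: eq_bigr => -[f g] _.
by apply: eq_bigr => k _; rewrite ffunE.
Qed.
End FusedTrace.

(** * The twisted fusion point of one site *)

Section FusionPoint.
Variables (C : numClosedFieldType) (l : nat) (eta : C).
Variables (K : 'M[C]_2) (uK : K \in unitmx).

(** Factor k of the fusion is evaluated at [shifted_xi] of index l - 1 plus (l - k - 1) eta;
    relative to xi_n this is eta (l/2 - 1/2 - k). *)
Definition fusion_lax (k : 'I_l) (p r : 'I_2) : 'M[C]_l.+1 :=
  \sum_c K p c *: site_lax l eta (eta * (l%:R / 2 - 2^-1 - k%:R)) c r.

Lemma contract_fusion_lax (x y : 'rV[C]_2) k :
  \sum_p \sum_r (x 0 p * y 0 r) *: fusion_lax k p r =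
  \sum_c \sum_r ((x *m K) 0 c * y 0 r) *:
    site_lax l eta (eta * (l%:R / 2 - 2^-1 - k%:R)) c r.
Proof.
rewrite exchange_big [RHS]exchange_big; apply: eq_bigr => r _ /=.
under eq_bigr do rewrite scaler_sumr.
rewrite exchange_big; apply: eq_bigr => c _ /=.
rewrite mxE mulr_suml scaler_suml; apply: eq_bigr => p _.
by rewrite scalerA; congr (_ *: _); ring.
Qed.

(** The right-hand side is the permutation of Sym^l and the spin space composed with the twist, up
    to a constant. Contractions with x^l and y^l agree when xK.y is nonzero; as [K] is invertible,
    this is generic in y for each affine x, and density in y, then in x, concludes. *)
Lemma fused_mx_fusion_lax i j :
  fused_mx fusion_lax i j =
  (l`!%:R * eta ^+ l) *: (delta_mx j 0 *m row i (fused_twist l K)).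
Proof.
pose c := l`!%:R * eta ^+ l.
apply/matrixP => r s.
(* For a fixed operator entry, the difference as a matrix in the auxiliary indices: tested on one
   side by x^l and, after transposition, on the other by y^l. *)
pose A : 'M[C]_l.+1 := \matrix_(i, j)
  (fused_mx fusion_lax i j - c *: (delta_mx j 0 *m row i (fused_twist l K))) r s.
suff A0 : A = 0.
  have : A i j = 0 by rewrite A0 mxE.
  by rewrite !mxE => /eqP; rewrite subr_eq0 => /eqP.
apply: (sym_row_separates (oner_neq0 _)) => t _.
set x := affine_row t.
apply: trmx_inj; rewrite trmx0.
pose x' := x *m K.
pose g : {poly C} := (x' 0 0)%:P + x' 0 1 *: 'X.
have gE z : g.[z] = dot2 x' (affine_row z).
  by rewrite /g !hornerE /= /dot2 !mxE /= mulr1.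
apply: (@sym_row_separates _ _ _ _ g) => [|z].
  have: x' != 0.
    apply: contraTneq isT => x'0; have : x = 0.
      by rewrite -[x](mulmxK uK) -/x' x'0 mul0mx.
    by move/rowP/(_ 0)/eqP; rewrite !mxE /= oner_eq0.
  apply: contraNneq => g0; apply/eqP/rowP => k; rewrite [RHS]mxE.
  have e0 : g`_0 = x' 0 0 by rewrite /g coefD coefC coefZ coefX mulr0 addr0.
  have e1 : g`_1 = x' 0 1 by rewrite /g coefD coefC coefZ coefX mulr1 add0r.
  move: e0 e1; rewrite g0 !coef0 => e0 e1.
  case: k => [[|[|]]] //= p; first by rewrite [RHS]e0; congr fun_of_matrix; apply: val_inj.
  by rewrite [RHS]e1; congr fun_of_matrix; apply: val_inj.
rewrite gE => xy; set y := affine_row z in xy *.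
have key : \sum_i \sum_j (sym_row l x 0 i * sym_row l y 0 j) *: fused_mx fusion_lax i j
    = c *: ((sym_row l y)^T *m sym_row l x').
  rewrite contract_fused_mx -(prod_contract_site_lax l eta xy).
  by apply: eq_bigr => k _; rewrite contract_fusion_lax.
have key2 : \sum_i \sum_j (sym_row l x 0 i * sym_row l y 0 j) *:
     (c *: (delta_mx j (0 : 'I_1) *m row i (fused_twist l K)))
    = c *: ((sym_row l y)^T *m sym_row l x').
  rewrite -sym_row_fused_twist.
  under eq_bigr do under eq_bigr do rewrite scalerA mulrC -scalerA.
  under eq_bigr do rewrite -scaler_sumr.
  rewrite -scaler_sumr; congr (_ *: _).
  rewrite [in RHS](row_sum_delta (sym_row l x)) mulmx_suml mulmx_sumr.
  apply: eq_bigr => a _.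
  rewrite [in RHS](row_sum_delta (sym_row l y)) (linear_sum (@trmx C 1 l.+1)) /=.
  rewrite mulmx_suml; apply: eq_bigr => b _.
  rewrite linearZ /= trmx_delta -!scalemxAl -rowE -scalemxAr scalerA.
  by rewrite mulrC.
apply/matrixP => u v; rewrite [u]ord1 [v]ord1 [RHS]mxE.
have := congr1 (fun X : 'M[C]_l.+1 => X r s) (etrans key (esym key2)).
move/eqP; rewrite -subr_eq0 !summxE -sumrB => /eqP <-.
rewrite mxE; under eq_bigr do rewrite [X in _ * X]mxE [X in _ * X]mxE mulr_sumr.
rewrite exchange_big; apply: eq_bigr => a _; rewrite !summxE -sumrB.
by apply: eq_bigr => b _; rewrite !mxE; ring.
Qed.

Lemma fused_trace_fusion_lax :
  \tr (fused_mx fusion_lax) = (l`!%:R * eta ^+ l) *: fused_twist l K.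
Proof.
rewrite /mxtrace (eq_bigr _ (fun i _ => fused_mx_fusion_lax i i)) -scaler_sumr.
congr (_ *: _); rewrite -[RHS]mul1mx mx1_sum_delta mulmx_suml.
by apply: eq_bigr => i _; rewrite rowE mulmxA mul_delta_mx.
Qed.
End FusionPoint.

(** * One-site operators and product covectors on the chain *)

Section LocalOperators.
Variables (C : numClosedFieldType) (N : nat) (l : 'I_N -> nat).

Local Notation covectors := (forall n : 'I_N, 'rV[C]_((l n).+1)).

Definition set_row (w : covectors) n (x : 'rV[C]_((l n).+1)) : covectors :=
  dfwith (T := fun m => 'rV[C]_((l m).+1)) w x.

Local Notation site n A := (@local_op C N l n A).

Lemma sum_conf (V : nmodType) (F : conf l -> V) :
  \sum_(a < hdim l) F (conf_val a) = \sum_f F f.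
Proof. by rewrite [RHS](reindex _ (onW_bij _ (@enum_val_bij (conf l)))). Qed.

Definition set_conf (f : conf l) n (j : 'I_(l n).+1) : conf l :=
  [ffun m => dfwith (T := fun m => 'I_(l m).+1) f j m].

Lemma set_confE f n j : @set_conf f n j n = j.
Proof. by rewrite ffunE dfwith_in. Qed.

Lemma set_confN f n j m : n != m -> @set_conf f n j m = f m.
Proof. by move=> nm; rewrite ffunE dfwith_out. Qed.

Lemma sum_agree (V : nmodType) (c : conf l) n (F : conf l -> V) :
  \sum_(f : conf l | [forall m, (m != n) ==> (f m == c m)]) F f
  = \sum_j F (@set_conf c n j).
Proof.
rewrite (reindex_onto (fun j => @set_conf c n j) (fun f => f n)) /=.
  apply: eq_bigl => j; rewrite set_confE eqxx andbT.
  by apply/forallP => m; apply/implyP => mn; rewrite set_confN // eq_sym.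
move=> f /forallP h; apply/ffunP => m; have [<-|nm] := eqVneq n m.
  by rewrite set_confE.
by rewrite set_confN //; have := h m; rewrite eq_sym nm /= => /eqP.
Qed.

Lemma eq_tensor_covector (w w' : covectors) :
  (forall n, w n = w' n) -> tensor_covector w = tensor_covector w'.
Proof. by move=> e; apply/rowP => a; rewrite !mxE; apply: eq_bigr => n _; rewrite e. Qed.

Lemma tensor_covector_local_op (w : covectors) n A :
  tensor_covector w *m site n A = tensor_covector (set_row w (w n *m A)).
Proof.
apply/rowP => c; rewrite !mxE.
pose G (f : conf l) := (\prod_m w m 0 (f m)) * A (f n) (conf_val c n).
transitivity (\sum_(f : conf l | [forall m, (m != n) ==> (f m == conf_val c m)]) G f).
  rewrite [RHS]big_mkcond -sum_conf; apply: eq_bigr => a _; rewrite !mxE.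
  by case: ifP => _; rewrite ?mulr0.
rewrite sum_agree (bigD1 n) //= /set_row dfwith_in mxE mulr_suml.
apply: eq_bigr => j _; rewrite /G set_confE mulrAC (bigD1 n) //= set_confE.
congr (_ * _ * _); apply: eq_bigr => m mn.
by rewrite set_confN 1?eq_sym // dfwith_out // eq_sym.
Qed.

Definition delta_covectors (f : conf l) : covectors := fun n => delta_mx 0 (f n).

Lemma tensor_delta_covectors f :
  tensor_covector (delta_covectors f) = delta_mx 0 (enum_rank f).
Proof.
apply/rowP => a; rewrite !mxE eqxx /=.
have -> : (a == enum_rank f) = (conf_val a == f).
  by rewrite /conf_val; apply/eqP/eqP => [->|<-]; rewrite ?enum_rankK ?enum_valK.
case: eqP => [<-|ne]; first by rewrite big1 // => n _; rewrite mxE !eqxx.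
have [n nf] : exists n, conf_val a n != f n.
  apply/existsP; apply: contraPT ne; rewrite negb_exists => /forallP h.
  by apply; apply/ffunP => n; apply/eqP; rewrite -[_ == _]negbK.
by rewrite (bigD1 n) //= mxE (negPf nf) andbF mul0r.
Qed.

(** Product covectors include the canonical basis, so operator identities on the chain can be
    checked site by site. *)
Lemma tensor_covector_ext m (A B : 'M[C]_(hdim l, m)) :
  (forall w, tensor_covector w *m A = tensor_covector w *m B) -> A = B.
Proof.
move=> h; apply/row_matrixP => a; rewrite !rowE.
by have := h (delta_covectors (conf_val a)); rewrite tensor_delta_covectors enum_valK.
Qed.

Lemma set_rowE w n x : @set_row w n x n = x.
Proof. exact: dfwith_in. Qed.

Lemma set_rowN w n x m : n != m -> @set_row w n x m = w m.
Proof. by move=> nm; rewrite /set_row dfwith_out. Qed.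

Lemma local_opM n A B : site n (A *m B) = site n A *m site n B.
Proof.
apply: tensor_covector_ext => w; rewrite mulmxA !tensor_covector_local_op.
apply: eq_tensor_covector => m; have [<-|nm] := eqVneq n m.
  by rewrite !set_rowE mulmxA.
by rewrite !set_rowN.
Qed.

Lemma local_op_comm n m A B : n != m ->
  site n A *m site m B = site m B *m site n A.
Proof.
move=> nm; have mn : m != n by rewrite eq_sym.
apply: tensor_covector_ext => w; rewrite !mulmxA !tensor_covector_local_op.
apply: eq_tensor_covector => k; have [<-|nk] := eqVneq n k.
  by rewrite [LHS]set_rowN // !set_rowE set_rowN.
have [<-|mk] := eqVneq m k; first by rewrite set_rowE [RHS]set_rowN // set_rowE set_rowN.
by rewrite !set_rowN.
Qed.

Lemma local_opD n A B : site n (A + B) = site n A + site n B.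
Proof. by apply/matrixP => a b; rewrite !mxE; case: ifP; rewrite ?addr0. Qed.

Lemma local_opZ n c A : site n (c *: A) = c *: site n A.
Proof. by apply/matrixP => a b; rewrite !mxE; case: ifP; rewrite ?mulr0. Qed.

Lemma local_op_scalar n c : site n c%:M = c%:M.
Proof.
rewrite -scalemx1 local_opZ -[RHS]scalemx1; congr (_ *: _).
apply: tensor_covector_ext => w; rewrite tensor_covector_local_op mulmx1 !mulmx1.
apply: eq_tensor_covector => m; have [<-|nm] := eqVneq n m.
  by rewrite set_rowE.
by rewrite set_rowN.
Qed.

Lemma local_op_sum n (I : Type) (r : seq I) (P : pred I) F :
  site n (\sum_(i <- r | P i) F i) = \sum_(i <- r | P i) site n (F i).
Proof.
elim/big_rec2: _ => [|i A B _ <-]; last by rewrite local_opD.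
by have := local_op_scalar n 0; rewrite !raddf0.
Qed.

Lemma local_op_prod n q F :
  site n (\prod_(i < q) F i) = \prod_(i < q) site n (F i).
Proof. elim/big_rec2: _ => [|i A B _ <-]; last by rewrite -!mulmxE local_opM.
exact: local_op_scalar. Qed.

Lemma local_op_exp n A k : site n (A ^+ k) = site n A ^+ k.
Proof.
by rewrite -[k]card_ord -!prodr_const local_op_prod.
Qed.

Definition tensor_op (G : forall n : 'I_N, 'M[C]_((l n).+1)) : 'M[C]_(hdim l) :=
  \prod_(n < N) site n (G n).

Lemma tensor_covector_op w G :
  tensor_covector w *m tensor_op G = tensor_covector (fun n => w n *m G n).
Proof.
rewrite /tensor_op.
have -> : tensor_covector (fun n => w n *m G n) =
   tensor_covector (fun n => if n \in index_enum 'I_N then w n *m G n else w n).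
  by apply: eq_tensor_covector => n; rewrite mem_index_enum.
elim: (index_enum _) (index_enum_uniq 'I_N) w => [|n r IH] /=.
  by move=> _ w; rewrite big_nil mulmx1; apply: eq_tensor_covector.
case/andP=> nr ur w; rewrite big_cons -mulmxE mulmxA tensor_covector_local_op IH //.
apply: eq_tensor_covector => m; rewrite inE.
have [<-|nm] := eqVneq n m; first by rewrite (negPf nr) set_rowE.
by rewrite set_rowN.
Qed.

Lemma tensor_op_unit G : (forall n, G n \in unitmx) -> tensor_op G \in unitmx.
Proof.
move=> uG; suff : tensor_op G *m tensor_op (fun n => invmx (G n)) = 1%:M.
  by case/mulmx1_unit.
apply: tensor_covector_ext => w; rewrite mulmxA !tensor_covector_op mulmx1.
by apply: eq_tensor_covector => n; rewrite mulmxK.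
Qed.

Lemma local_op_tensor_op n G Y D : Y *m G n = G n *m D ->
  site n Y *m tensor_op G = tensor_op G *m site n D.
Proof.
move=> e; apply: tensor_covector_ext => w; rewrite !mulmxA.
rewrite tensor_covector_local_op !tensor_covector_op tensor_covector_local_op.
apply: eq_tensor_covector => m; have [<-|nm] := eqVneq n m.
  by rewrite !set_rowE -!mulmxA e.
by rewrite !set_rowN.
Qed.

Lemma local_op_diag n d :
  site n (diag_mx d) = diag_mx (\row_a d 0 (conf_val a n)).
Proof.
apply/matrixP => a b; rewrite !mxE; have [<-|ab] := eqVneq a b.
  by rewrite eqxx; case: ifP => // /forallP[] m; apply/implyP.
rewrite mulr0n; case: ifP => // /forallP h; case: eqP => [e|//]; exfalso.
move/negP: ab; apply; apply/eqP/enum_val_inj/ffunP => m.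
by have [->|mn] := eqVneq m n; [|have := h m; rewrite mn => /eqP].
Qed.
End LocalOperators.

(** * Closure properties of polynomial dependence *)

Section FunctionRings.
Variables (T : Type).

(** One calculus for functions polynomial in tau, polynomial in the coordinates of a vector, or with
    values in polynomials and controlled coefficientwise. Extensionality is a field because
    functions are compared pointwise. *)
Record fun_ring (A : comNzRingType) (S : (T -> A) -> Prop) : Prop := FunRing {
  fun_ring_ext : forall f g, f =1 g -> S f -> S g;
  fun_ring_cst : forall c, S (fun=> c);
  fun_ring_add : forall f g, S f -> S g -> S (fun t => f t + g t);
  fun_ring_mul : forall f g, S f -> S g -> S (fun t => f t * g t) }.

Section Closure.
Variables (A : comNzRingType) (S : (T -> A) -> Prop).
Hypothesis SR : fun_ring S.

Lemma fun_ring_sum (I : Type) (r : seq I) (P : pred I) (F : I -> T -> A) :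
  (forall i, P i -> S (F i)) -> S (fun t => \sum_(i <- r | P i) F i t).
Proof.
move=> h; elim: r => [|i r IH].
  by apply: (fun_ring_ext SR _ (fun_ring_cst SR 0)) => t; rewrite big_nil.
have [Pi|nPi] := boolP (P i).
  apply: (fun_ring_ext SR _ (fun_ring_add SR (h i Pi) IH)) => t.
  by rewrite big_cons Pi.
by apply: (fun_ring_ext SR _ IH) => t; rewrite big_cons (negPf nPi).
Qed.

Lemma fun_ring_prod (I : Type) (r : seq I) (P : pred I) (F : I -> T -> A) :
  (forall i, P i -> S (F i)) -> S (fun t => \prod_(i <- r | P i) F i t).
Proof.
move=> h; elim: r => [|i r IH].
  by apply: (fun_ring_ext SR _ (fun_ring_cst SR 1)) => t; rewrite big_nil.
have [Pi|nPi] := boolP (P i).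
  apply: (fun_ring_ext SR _ (fun_ring_mul SR (h i Pi) IH)) => t.
  by rewrite big_cons Pi.
by apply: (fun_ring_ext SR _ IH) => t; rewrite big_cons (negPf nPi).
Qed.

Lemma fun_ring_sub f g : S f -> S g -> S (fun t => f t - g t).
Proof.
move=> Sf Sg.
apply: (fun_ring_ext SR _ (fun_ring_add SR Sf (fun_ring_mul SR (fun_ring_cst SR (-1)) Sg))).
by move=> t; rewrite mulN1r.
Qed.

Definition entries_in m n (F : T -> 'M[A]_(m, n)) := forall i j, S (fun t => F t i j).

Lemma entries_in_ext m n (F G : T -> 'M[A]_(m, n)) :
  F =1 G -> entries_in F -> entries_in G.
Proof. by move=> e h i j; apply: (fun_ring_ext SR _ (h i j)) => t; rewrite e. Qed.

Lemma entries_in_cst m n (X : 'M[A]_(m, n)) : entries_in (fun=> X).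
Proof. by move=> i j; apply: (fun_ring_cst SR). Qed.

Lemma entries_in_add m n (F G : T -> 'M[A]_(m, n)) :
  entries_in F -> entries_in G -> entries_in (fun t => F t + G t).
Proof.
move=> hF hG i j; apply: (fun_ring_ext SR _ (fun_ring_add SR (hF i j) (hG i j))).
by move=> t; rewrite mxE.
Qed.

Lemma entries_in_scale m n f (F : T -> 'M[A]_(m, n)) :
  S f -> entries_in F -> entries_in (fun t => f t *: F t).
Proof.
move=> hf hF i j; apply: (fun_ring_ext SR _ (fun_ring_mul SR hf (hF i j))).
by move=> t; rewrite mxE.
Qed.

Lemma entries_in_mul m n p (F : T -> 'M[A]_(m, n)) (G : T -> 'M[A]_(n, p)) :
  entries_in F -> entries_in G -> entries_in (fun t => F t *m G t).
Proof.
move=> hF hG i j; apply: (fun_ring_ext SR (f := fun t => \sum_k F t i k * G t k j)).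
  by move=> t; rewrite mxE.
by apply: fun_ring_sum => k _; apply: (fun_ring_mul SR).
Qed.

Lemma entries_in_sum m n (I : Type) (r : seq I) (P : pred I) (F : I -> T -> 'M[A]_(m, n)) :
  (forall i, P i -> entries_in (F i)) ->
  entries_in (fun t => \sum_(k <- r | P k) F k t).
Proof.
move=> h i j; apply: (fun_ring_ext SR (f := fun t => \sum_(k <- r | P k) F k t i j)).
  by move=> t; rewrite summxE.
by apply: fun_ring_sum => k Pk; apply: h.
Qed.

Lemma entries_in_prod n (I : Type) (r : seq I) (P : pred I) (F : I -> T -> 'M[A]_n) :
  (forall i, P i -> entries_in (F i)) ->
  entries_in (fun t => \prod_(k <- r | P k) F k t).
Proof.
move=> h; elim: r => [|i r IH].
  by apply: (entries_in_ext _ (entries_in_cst 1%:M)) => t; rewrite big_nil.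
have [Pi|nPi] := boolP (P i).
  apply: (entries_in_ext _ (entries_in_mul (h i Pi) IH)) => t.
  by rewrite big_cons Pi.
by apply: (entries_in_ext _ IH) => t; rewrite big_cons (negPf nPi).
Qed.

Lemma entries_in_exp n k (F : T -> 'M[A]_n) :
  entries_in F -> entries_in (fun t => F t ^+ k).
Proof.
move=> h; have := @entries_in_prod n _ (index_enum 'I_k) xpredT (fun=> F) (fun _ _ => h).
by apply: entries_in_ext => t; rewrite prodr_const card_ord.
Qed.

Lemma fun_ring_det n (F : T -> 'M[A]_n) : entries_in F -> S (fun t => \det (F t)).
Proof.
move=> h; apply: fun_ring_sum => s _.
by apply: (fun_ring_mul SR); [apply: (fun_ring_cst SR)|apply: fun_ring_prod].
Qed.
End Closure.

(** Makes [fun_ring_det] applicable to [char_poly_mx], whose determinant carries the coefficients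
    that enter [disc]. *)
Lemma fun_ring_poly (A : comNzRingType) (S : (T -> A) -> Prop) : fun_ring S ->
  fun_ring (fun F : T -> {poly A} => forall k, S (fun t => (F t)`_k)).
Proof.
move=> SR; split=> [f g e h k|c k|f g hf hg k|f g hf hg k].
- by apply: (fun_ring_ext SR _ (h k)) => t; rewrite e.
- exact: (fun_ring_cst SR).
- by apply: (fun_ring_ext SR _ (fun_ring_add SR (hf k) (hg k))) => t; rewrite coefD.
apply: (fun_ring_ext SR (f := fun t => \sum_(i < k.+1) (f t)`_i * (g t)`_(k - i))).
  by move=> t; rewrite coefM.
by apply: (fun_ring_sum SR) => i _; apply: (fun_ring_mul SR).
Qed.

(* The eigenvalues of this matrix are the values of the derivative of char_poly X
   at its roots, so disc X <> 0 iff these roots are simple. *)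
Definition disc (A : comNzRingType) n (X : 'M[A]_n) : A :=
  \det (\sum_(k < n) ((char_poly X)^`())`_k *: X ^+ k).

Lemma fun_ring_disc (A : comNzRingType) (S : (T -> A) -> Prop) n (F : T -> 'M[A]_n) :
  fun_ring S -> entries_in S F -> S (fun t => disc (F t)).
Proof.
move=> SR h; apply: (fun_ring_det SR); apply: (entries_in_sum SR) => k _.
apply: (entries_in_scale SR); last exact: (entries_in_exp SR).
apply: (fun_ring_ext SR (f := fun t => (char_poly (F t))`_k.+1 * k.+1%:R)).
  by move=> t; rewrite coef_deriv mulr_natr.
apply: (fun_ring_mul SR); last exact: (fun_ring_cst SR).
have := @fun_ring_det _ _ (fun_ring_poly SR) n (fun t => char_poly_mx (F t)).
move=> /(_ _ k.+1); apply => i j {}k.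
apply: (fun_ring_ext SR (f := fun t => ('X *+ (i == j))`_k - ((F t) i j)%:P`_k)).
  by move=> t; rewrite !mxE coefB.
apply: (fun_ring_sub SR); first exact: (fun_ring_cst SR).
apply: (fun_ring_ext SR (f := fun t => F t i j * (k == 0%N)%:R)).
  by move=> t; rewrite coefC; case: eqP; rewrite ?mulr1 ?mulr0.
by apply: (fun_ring_mul SR); [|exact: (fun_ring_cst SR)].
Qed.
End FunctionRings.

(** * Polynomial functions and generic nonvanishing *)

Section PolynomialFunctions.
Variable C : numClosedFieldType.

Definition poly_fun (f : C -> C) := exists p : {poly C}, forall t, f t = p.[t].

Definition mpoly_fun n (f : 'rV[C]_n -> C) :=
  exists p : {mpoly C[n]}, forall x, f x = p.@[x ord0].

Lemma poly_funR : fun_ring poly_fun.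
Proof.
split=> [f g e [p hp]|c|f g [p hp] [q hq]|f g [p hp] [q hq]].
- by exists p => t; rewrite -e.
- by exists c%:P => t; rewrite hornerC.
- by exists (p + q) => t; rewrite hornerD hp hq.
by exists (p * q) => t; rewrite hornerM hp hq.
Qed.

Lemma poly_fun_id : poly_fun id.
Proof. by exists 'X => t; rewrite hornerX. Qed.

Lemma mpoly_funR n : fun_ring (@mpoly_fun n).
Proof.
split=> [f g e [p hp]|c|f g [p hp] [q hq]|f g [p hp] [q hq]].
- by exists p => t; rewrite -e.
- by exists c%:MP => t; rewrite mevalC.
- by exists (p + q) => t; rewrite mevalD hp hq.
by exists (p * q) => t; rewrite mevalM hp hq.
Qed.

Lemma mpoly_fun_coord n (i : 'I_n) : mpoly_fun (fun x => x 0 i).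
Proof. by exists 'X_i => x; rewrite mevalXU. Qed.

(** Passes from the limit tau = 0 to an actual value of tau: the polynomial is multiplied by ['X]
    before a non-root is chosen, which excludes 0. *)
Lemma poly_fun_neq0 f : poly_fun f -> f 0 != 0 -> exists2 t : C, t != 0 & f t != 0.
Proof.
case=> p hp; rewrite hp => p0.
have : p * 'X != 0.
  rewrite mulf_neq0 ?polyX_eq0 //; apply: contraNneq p0 => ->.
  by rewrite horner0.
case/closed_nonrootP => t; rewrite rootM negb_or rootX => /andP[pt t0].
by exists t => //; rewrite hp.
Qed.

Lemma poly_fun_eq0 f g t0 : poly_fun f -> poly_fun g -> g t0 != 0 ->
  (forall t, g t != 0 -> f t = 0) -> forall t, f t = 0.
Proof.
case=> p hp [q hq] q0 h.
have : p * q = 0.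
  apply/eqP/negPn/closed_nonrootP => -[t]; rewrite rootM negb_or /root -hp -hq.
  by by case/andP=> ft /h f0; rewrite f0 eqxx in ft.
move/eqP; rewrite mulf_eq0 => /orP[/eqP p0|/eqP q0'] t.
  by rewrite hp p0 horner0.
by rewrite hq q0' horner0 eqxx in q0.
Qed.

Lemma almost_all_neq0 n (f : 'rV[C]_n -> C) (S : 'rV[C]_n -> Prop) x0 :
  mpoly_fun f -> f x0 != 0 -> (forall x, f x != 0 -> S x) -> almost_all S.
Proof.
case=> p hp fx0 h; exists p; split=> [|x]; last by rewrite -hp; exact: h.
by apply: contraNneq fx0 => p0; rewrite hp p0 meval0.
Qed.
End PolynomialFunctions.

(** * Simple spectrum as a polynomial condition *)

Section SimpleDiagonalization.
Variable C : numClosedFieldType.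

Definition simple_diag n (X : 'M[C]_n) := exists2 U, U \in unitmx &
  exists2 d : 'rV[C]_n, injective (d 0) & X *m U = U *m diag_mx d.

Lemma simple_diagZ n (X : 'M[C]_n) c : c != 0 -> simple_diag X -> simple_diag (c *: X).
Proof.
move=> c0 [U uU [d dI XU]]; exists U => //; exists (c *: d).
  by move=> i j; rewrite !mxE => /(mulfI c0)/dI.
by rewrite -scalemxAl XU scalemxAr; congr (_ *m _); rewrite linearZ.
Qed.

Lemma diag_conj_exp n (X U : 'M[C]_n) d k : X *m U = U *m diag_mx d ->
  X ^+ k *m U = U *m diag_mx (\row_i d 0 i ^+ k).
Proof.
move=> XU; elim: k => [|k IH].
  rewrite expr0 mul1mx -[LHS]mulmx1; congr (_ *m _).
  by apply/matrixP => i j; rewrite !mxE.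
rewrite exprS -mulmxE -mulmxA IH mulmxA XU -mulmxA mulmx_diag.
by congr (_ *m diag_mx _); apply/rowP => i; rewrite !mxE exprS.
Qed.

Lemma char_poly_diag_conj n (X U : 'M[C]_n) d : U \in unitmx ->
  X *m U = U *m diag_mx d -> char_poly X = \prod_i ('X - (d 0 i)%:P).
Proof.
move=> uU XU.
have -> : \prod_i ('X - (d 0 i)%:P) = char_poly (diag_mx d).
  rewrite char_poly_trig ?diag_mx_is_trig //.
  by apply: eq_bigr => i _; rewrite mxE eqxx.
have h : char_poly_mx X *m map_mx polyC U = map_mx polyC U *m char_poly_mx (diag_mx d).
  rewrite mulmxBl mulmxBr -!map_mxM XU; congr (_ - _).
  by rewrite mul_scalar_mx mul_mx_scalar.
have := congr1 determinant h; rewrite !det_mulmx [RHS]mulrC => /mulIf; apply.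
by rewrite det_map_mx polyC_eq0 -unitfE -unitmxE.
Qed.

(** If the eigenvalues are distinct, [disc X] is the product of the derivative of [char_poly X] at
    them. Conversely, a common root of [char_poly X] and its derivative has a left eigenvector
    annihilated by the matrix inside [disc]. *)
Lemma disc_neq0 n (X : 'M[C]_n) : disc X != 0 <-> simple_diag X.
Proof.
have size_dchar : (size (char_poly X)^`() <= n)%N.
  rewrite -ltnS -(size_char_poly X) lt_size_deriv //.
  by rewrite monic_neq0 ?char_poly_monic.
have horner_dchar z : (char_poly X)^`().[z]
    = \sum_(k < n) ((char_poly X)^`())`_k * z ^+ k.
  exact: horner_coef_wide.
split; last first.
  case=> U uU [d dI XU].
  have e : (\sum_(k < n) ((char_poly X)^`())`_k *: X ^+ k) *m U
      = U *m diag_mx (\row_i (char_poly X)^`().[d 0 i]).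
    rewrite mulmx_suml.
    under eq_bigr do rewrite -scalemxAl (diag_conj_exp _ XU) scalemxAr.
    rewrite -mulmx_sumr; congr (_ *m _).
    apply/matrixP => i j; rewrite summxE !mxE horner_dchar.
    rewrite -sumrMnl; apply: eq_bigr => k _.
    by rewrite !mxE mulrnAr.
  have := congr1 determinant e; rewrite !det_mulmx det_diag mulrC.
  have uU' : \det U != 0 by rewrite -unitfE -unitmxE.
  move/(mulfI uU'); rewrite -/(disc X) => ->.
  apply/prodf_neq0 => i _; rewrite mxE.
  have : separable_poly (char_poly X).
    rewrite (char_poly_diag_conj uU XU) -(big_map (d 0) xpredT (fun z => 'X - z%:P)).
    by rewrite separable_prod_XsubC map_inj_uniq ?index_enum_uniq.
  rewrite unlock => /coprimep_root; apply.
  rewrite (char_poly_diag_conj uU XU) (bigD1 i) //= rootM root_XsubC eqxx //.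
case: n X size_dchar horner_dchar => [|n] X size_dchar horner_dchar dX.
  exists 1%:M; first exact: unitmx1.
  by exists 0 => [[]//|]; apply/matrixP => -[].
have [r Dr] := closed_field_poly_normal (char_poly X).
move: Dr; rewrite (monicP (char_poly_monic X)) scale1r => Dr.
have ur : uniq r.
  rewrite -separable_prod_XsubC -Dr; apply: contraNT dX => nsep.
  have /closed_rootP[z] : size (gcdp (char_poly X) (char_poly X)^`()) != 1%N.
    by move: nsep; rewrite unlock.
  rewrite root_gcd => /andP[]; rewrite -eigenvalue_root_char => /eigenvalueP[v vX v0].
  move=> z0; apply/det0P; exists v => //.
  have vXk k : v *m X ^+ k = z ^+ k *: v.
    elim: k => [|k IH]; first by rewrite expr0 mulmx1 scale1r.
    by rewrite exprS -mulmxE mulmxA vX -scalemxAl IH scalerA exprS.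
  rewrite mulmx_sumr; under eq_bigr do rewrite -scalemxAr vXk scalerA.
  by rewrite -scaler_suml -horner_dchar (eqP z0) scale0r.
have szr : size r = n.+1.
  by have := size_char_poly X; rewrite Dr size_prod_XsubC => -[].
have /diagonalizableP[P uP dP] : exists2 rs : seq C, uniq rs &
    mxminpoly X %| \prod_(x <- rs) ('X - x%:P).
  by exists r => //; rewrite -Dr mxminpoly_dvd_char.
pose d := \row_i conjmx P X i i.
exists (invmx P); first by rewrite unitmx_inv.
have dE k : d 0 k = conjmx P X k k by rewrite [LHS]mxE.
exists d.
  have mX := similar_diag_mxminpoly uP dP.
  (* The n + 1 distinct roots all occur among the n + 1 diagonal entries, which are therefore
     distinct. *)
  have sub : {subset r <= undup [seq conjmx P X i i | i <- enum 'I_n.+1]}.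
    move=> z zr; rewrite -root_prod_XsubC -mX root_mxminpoly Dr.
    by rewrite root_prod_XsubC.
  have := uniq_leq_size ur sub; rewrite szr => sz.
  have /injectiveP dI : injectiveb (fun i => conjmx P X i i).
    rewrite /injectiveb /dinjectiveb -[uniq _]negbK -ltn_size_undup -leqNgt.
    by rewrite size_map size_enum_ord.
  by move=> i j; rewrite !dE; exact: dI.
apply: (can_inj (mulKmx uP)).
rewrite !mulmxA mulmxV // mul1mx -conjumx //.
apply/matrixP => i j; rewrite [RHS]mxE.
have [->|ij] := eqVneq i j; first by rewrite dE mulr1n.
by rewrite mulr0n; move/(similar_diagPp): dP; apply.
Qed.

(** Eigenspaces consist of row vectors: two equal diagonal entries would put two independent rows of
    [invmx U] in one eigenspace. *)
Lemma simple_spectrum_diag n (X U : 'M[C]_n) d : U \in unitmx ->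
  X *m U = U *m diag_mx d -> simple_spectrum X -> injective (d 0).
Proof.
move=> uU XU sX i j dij; apply/eqP; apply: contraTT (sX (d 0 i)) => ij.
rewrite -ltnNge; pose B := col_mx (row i (invmx U)) (row j (invmx U)).
have XU' : invmx U *m X = diag_mx d *m invmx U.
  apply: (can_inj (mulmxK uU)); rewrite -!mulmxA mulVmx // mulmx1 XU mulmxA.
  by rewrite mulVmx // mul1mx.
have rowE' k : row k (invmx U) *m X = d 0 k *: row k (invmx U).
  by rewrite -row_mul XU' row_mul row_diag_mx -scalemxAl -rowE.
have sB : (B <= eigenspace X (d 0 i))%MS.
  by apply/eigenspaceP; rewrite mul_col_mx !rowE' -dij scale_col_mx.
apply: leq_trans (mxrankS sB).
have -> : B = col_mx (delta_mx 0 i) (delta_mx 0 j) *m invmx U.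
  by rewrite mul_col_mx -!rowE.
rewrite mxrankMfree ?row_free_unit ?unitmx_inv //.
suff /eqP -> : row_free (col_mx (delta_mx 0 i) (delta_mx 0 j) : 'M[C]_(1 + 1, n)) by [].
apply/row_freeP; exists (row_mx (delta_mx i 0) (delta_mx j 0)).
have ji : j != i by rewrite eq_sym.
rewrite mul_col_row !mul_delta_mx !mul_delta_mx_0 //.
transitivity (block_mx (1%:M : 'M[C]_1) 0 0 (1%:M : 'M[C]_1)).
  by congr block_mx; apply/matrixP => u v; rewrite [u]ord1 [v]ord1 !mxE.
exact/esym/scalar_mx_block.
Qed.
End SimpleDiagonalization.

(** * The exchange relation for monodromies and commutation of traces *)

Section ExchangeRelation.
Variables (C : numClosedFieldType) (eta : C).

(* The RLL relation at difference c of spectral parameters, in components. *)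
Definition exchange d c (A B : 'M['M[C]_d]_2) := forall i j k r,
  c *: (A i j *m B k r) + eta *: (A k j *m B i r)
  = c *: (B k r *m A i j) + eta *: (B k j *m A i r).

Definition entries_comm d (A B : 'M['M[C]_d]_2) :=
  forall i j k r, A i j *m B k r = B k r *m A i j.

(** Commutation across the two factors regroups each product as (AB)(A'B'); the relation is then
    applied to each pair, with the intermediate auxiliary indices carried along. *)
Lemma exchange_mul d c (A B A' B' : 'M['M[C]_d]_2) :
  exchange c A B -> exchange c A' B' -> entries_comm A' B -> entries_comm A B' ->
  exchange c (A *m A') (B *m B').
Proof.
move=> AB AB' A'B AcB' i j k r.
have lhs a b : (A *m A') a j *m (B *m B') b r =
    \sum_p \sum_q (A a p *m B b q) *m (A' p j *m B' q r).
  rewrite !mxE mulmx_suml; apply: eq_bigr => p _.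
  rewrite mulmx_sumr; apply: eq_bigr => q _.
  by rewrite -!mulmxE !mulmxA -[A a p *m A' p j *m B b q]mulmxA A'B !mulmxA.
have rhs a b : (B *m B') k a *m (A *m A') i b =
    \sum_p \sum_q (B k q *m A i p) *m (B' q a *m A' p b).
  rewrite !mxE exchange_big mulmx_suml; apply: eq_bigr => q _.
  rewrite mulmx_sumr; apply: eq_bigr => p _.
  by rewrite -!mulmxE !mulmxA -[B k q *m B' q a *m A i p]mulmxA -AcB' !mulmxA.
rewrite !lhs !rhs !scaler_sumr -!big_split /=.
transitivity (\sum_p \sum_q
   (c *: (B k q *m A i p) + eta *: (B k p *m A i q)) *m (A' p j *m B' q r)).
  apply: eq_bigr => p _; rewrite !scaler_sumr -big_split; apply: eq_bigr => q _.
  by rewrite -AB mulmxDl -!scalemxAl.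
transitivity (\sum_p \sum_q
   (B k q *m A i p) *m (c *: (A' p j *m B' q r) + eta *: (A' q j *m B' p r))).
  under eq_bigr do under eq_bigr do rewrite mulmxDl -!scalemxAl.
  under eq_bigr do rewrite big_split.
  rewrite big_split /= [X in _ + X]exchange_big -big_split; apply: eq_bigr => p _.
  rewrite -big_split; apply: eq_bigr => q _.
  by rewrite mulmxDr -!scalemxAr.
apply: eq_bigr => p _; rewrite !scaler_sumr -big_split; apply: eq_bigr => q _.
by rewrite AB' mulmxDr -!scalemxAr.
Qed.

(** Summing the relation over indices i, i, k, k and over i, k, k, i gives two linear equations in
    the commutator of the traces and [d1 - d2]; eliminating the latter leaves the factor c^2 -
    eta^2. *)
Lemma exchange_trace d c (A B : 'M['M[C]_d]_2) : exchange c A B ->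
  (c ^+ 2 - eta ^+ 2) *: (\tr A *m \tr B - \tr B *m \tr A) = 0.
Proof.
move=> AB.
pose d1 := \sum_i \sum_k A i k *m B k i.
pose d2 := \sum_i \sum_k B i k *m A k i.
have trM (X Y : 'M['M[C]_d]_2) : \tr X *m \tr Y = \sum_i \sum_k X i i *m Y k k.
  by rewrite /mxtrace mulmx_suml; apply: eq_bigr => i _; rewrite mulmx_sumr.
have sum_lin (F G : 'I_2 -> 'I_2 -> 'M[C]_d) :
    \sum_i \sum_k (c *: F i k + eta *: G i k)
    = c *: (\sum_i \sum_k F i k) + eta *: (\sum_i \sum_k G i k).
  rewrite !scaler_sumr -big_split; apply: eq_bigr => i _.
  by rewrite !scaler_sumr -big_split.
have d1E : d1 = \sum_i \sum_k A k i *m B i k by rewrite /d1 exchange_big.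
have d2E : d2 = \sum_i \sum_k B k i *m A i k by rewrite /d2 exchange_big.
have trE : \tr B *m \tr A = \sum_i \sum_k B k k *m A i i by rewrite trM exchange_big.
have e1 : c *: (\tr A *m \tr B) + eta *: d1 = c *: (\tr B *m \tr A) + eta *: d2.
  rewrite trM trE d1E d2E -!sum_lin.
  by apply: eq_bigr => i _; apply: eq_bigr => k _; apply: AB.
have e2 : c *: d1 + eta *: (\tr A *m \tr B) = c *: d2 + eta *: (\tr B *m \tr A).
  have trE' : \tr A *m \tr B = \sum_i \sum_k A k k *m B i i by rewrite trM exchange_big.
  rewrite trE' trE d2E /d1 -!sum_lin.
  apply: eq_bigr => i _; apply: eq_bigr => k _.
  exact: AB.
clear d1E d2E; move: (\tr A *m \tr B) (\tr B *m \tr A) d1 d2 e1 e2 => X Y D1 D2 e1 e2.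
apply/matrixP => u v; move/matrixP/(_ u v): e1; move/matrixP/(_ u v): e2.
rewrite !mxE; move: (X u v) (Y u v) (D1 u v) (D2 u v) => x y z w e2 e1.
have -> : (c ^+ 2 - eta ^+ 2) * (x - y) =
  c * ((c * x + eta * z) - (c * y + eta * w)) - eta * ((c * z + eta * x) - (c * w + eta * y)).
  by ring.
by rewrite e1 e2; ring.
Qed.

Lemma exchange_scalar d c (K : 'M[C]_2) :
  exchange c (scalar_entries d K) (scalar_entries d K).
Proof.
move=> i j k r; rewrite !mxE -!scalar_mxM.
by rewrite [K k r * _]mulrC.
Qed.

Lemma entries_comm_scalar d (K : 'M[C]_2) (A : 'M['M[C]_d]_2) :
  entries_comm (scalar_entries d K) A.
Proof. by move=> i j k r; rewrite mxE mul_scalar_mx mul_mx_scalar. Qed.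

Lemma entries_comm_sym d (A B : 'M['M[C]_d]_2) : entries_comm A B -> entries_comm B A.
Proof. by move=> h i j k r; rewrite h. Qed.

Lemma entries_comm_prod d (I : eqType) (r : seq I) (A : I -> 'M['M[C]_d]_2) B :
  (forall i, i \in r -> entries_comm (A i) B) ->
  entries_comm (\prod_(i <- r) A i) B.
Proof.
elim: r => [|n r IH] h i j k s.
  by rewrite big_nil !mxE; case: (i == j); rewrite ?mulr1n ?mulr0n ?mulmx1 ?mul1mx ?mulmx0 ?mul0mx.
rewrite big_cons !mxE mulmx_suml mulmx_sumr; apply: eq_bigr => p _.
rewrite -!mulmxE -mulmxA IH; last by move=> m mr; apply: h; rewrite inE mr orbT.
by rewrite mulmxA h ?mem_head // mulmxA.
Qed.

Lemma exchange_prod d c (I : eqType) (r : seq I) (A B : I -> 'M['M[C]_d]_2) :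
  uniq r -> (forall i, exchange c (A i) (B i)) ->
  (forall i j, i != j -> entries_comm (A i) (B j)) ->
  exchange c (\prod_(i <- r) A i) (\prod_(i <- r) B i).
Proof.
move=> + AB cAB; elim: r => [|n r IH] /=.
  rewrite !big_nil => _ i j k s; rewrite !mxE.
  by do 4!case: eqP => _; rewrite ?mulr1n ?mulr0n ?mulmx1 ?mul1mx ?mulmx0 ?mul0mx.
case/andP=> nr ur; rewrite !big_cons; apply: exchange_mul => //; first exact: IH.
  apply: entries_comm_prod => m mr; apply: cAB.
  by apply: contraNneq nr => <-.
apply/entries_comm_sym/entries_comm_prod => m mr; apply/entries_comm_sym/cAB.
by apply: contraNneq nr => ->.
Qed.
End ExchangeRelation.

(** * The exchange relation of a single site *)

Section SiteExchange.
Variables (C : numClosedFieldType) (l : nat) (eta : C).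

Definition spin_mx (i j : 'I_2) : 'M[C]_l.+1 :=
  if i == 0 then if j == 0 then spin_z C l else spin_minus C l
  else if j == 0 then spin_plus C l else - spin_z C l.

Lemma site_lax_spin_mx la i j : site_lax l eta la i j =
  ((la + eta / 2) * (i == j)%:R)%:M + eta *: spin_mx i j.
Proof.
case: i => [[|[|]]] //= p; case: j => [[|[|]]] //= q; rewrite /site_lax /spin_mx /=.
- by apply/matrixP => u v; rewrite !mxE; case: (u == v); rewrite ?mulr1n ?mulr0n; field.
- by apply/matrixP => u v; rewrite !mxE; case: (u == v); rewrite ?mulr1n ?mulr0n; ring.
- by apply/matrixP => u v; rewrite !mxE; case: (u == v); rewrite ?mulr1n ?mulr0n; ring.
by apply/matrixP => u v; rewrite !mxE; case: (u == v); rewrite ?mulr1n ?mulr0n; field.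
Qed.

Lemma spin_z_plus : spin_z C l *m spin_plus C l = spin_plus C l *m spin_z C l + spin_plus C l.
Proof.
apply/matrixP => i j; rewrite mul_diag_mx mul_mx_diag !mxE.
by case: eqP => [->|_]; rewrite ?mulr0 ?mul0r ?addr0 // -natr1; ring.
Qed.

Lemma spin_minus_z : spin_minus C l *m spin_z C l = spin_z C l *m spin_minus C l + spin_minus C l.
Proof.
have zt : (spin_z C l)^T = spin_z C l by rewrite tr_diag_mx.
by apply: trmx_inj; rewrite /spin_minus linearD /= !trmx_mul !trmxK zt spin_z_plus.
Qed.

Lemma spin_plus_minus :
  spin_plus C l *m spin_minus C l = spin_minus C l *m spin_plus C l + 2 *: spin_z C l.
Proof.
have e1 : spin_plus C l *m spin_minus C l = diag_mx (\row_(i < l.+1) (i.+1 * (l - i))%:R).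
  apply/matrixP => i j; rewrite !mxE.
  have [il|li] := ltnP i l; last first.
    rewrite big1 => [|k _].
      have -> : (l - i)%N = 0%N by lia.
      by rewrite muln0 mul0rn.
    by rewrite !mxE ifN ?mul0r //; have := ltn_ord k; lia.
  have il' : (i.+1 < l.+1)%N by [].
  rewrite (bigD1 (Ordinal il')) //= big1 => [|k ki]; last first.
    rewrite !mxE ifN ?mul0r //; apply: contra ki => /eqP e; exact/eqP/val_inj.
  rewrite !mxE /= eqxx addr0 eqSS; have [->|ij] := eqVneq i j.
    by rewrite eqxx mulr1n -expr2 sqrtCK.
  by rewrite ifN ?mulr0 ?mulr0n // eq_sym.
have e2 : spin_minus C l *m spin_plus C l = diag_mx (\row_(i < l.+1) (i * (l.+1 - i))%:R).
  apply/matrixP => i j; rewrite !mxE.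
  case: i => [[|i] il] /=.
    by rewrite big1 ?mul0rn // => k _; rewrite !mxE mul0r.
  rewrite (bigD1 (Ordinal (ltnW il))) //= big1 => [|k ki]; last first.
    rewrite !mxE ifN ?mul0r //= eqSS eq_sym.
    by apply: contra ki => /eqP e; exact/eqP/val_inj.
  rewrite !mxE /= eqxx addr0 subSS; have [<-|ij] := eqVneq (Ordinal il) j.
    by rewrite eqxx mulr1n -expr2 sqrtCK.
  rewrite ifN ?mulr0 ?mulr0n //.
  by apply: contra ij => /eqP e; apply/eqP/val_inj.
rewrite e1 e2; apply/matrixP => i j; rewrite !mxE.
case: (i == j); rewrite ?mulr1n ?mulr0n ?mulr0 ?addr0 //.
have il : (i <= l)%N by rewrite -ltnS.
rewrite !natrM !natrB ?(leqW il) // -!natr1.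
by field.
Qed.

(** All the sl_2 relations at once, in the index form of gl_2; the RLL relation reduces to them once
    the scalar parts are expanded. *)
Lemma spin_mx_comm i j k r : spin_mx i j *m spin_mx k r =
  spin_mx k r *m spin_mx i j + ((i == r)%:R *: spin_mx k j - (k == j)%:R *: spin_mx i r).
Proof.
have zp := spin_z_plus; have mz := spin_minus_z; have pm := spin_plus_minus.
rewrite /spin_mx.
case: i => [[|[|]]] //= pi; case: j => [[|[|]]] //= pj;
case: k => [[|[|]]] //= pk; case: r => [[|[|]]] //= pr;
rewrite ?mulNmx ?mulmxN ?opprK ?scale1r ?scale0r ?subr0 ?sub0r ?subrr ?addr0
  ?zp ?mz ?pm ?opprD ?opprK ?addrK ?subrK // ?scaler_nat ?mulr2n ?addrA ?addrK ?subrK //.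
Qed.

(** [phi] is to be the embedding of one site into the chain. *)
Lemma site_lax_exchange d (phi : 'M[C]_l.+1 -> 'M[C]_d) la mu :
  (forall A B, phi (A + B) = phi A + phi B) ->
  (forall c A, phi (c *: A) = c *: phi A) ->
  (forall A B, phi (A *m B) = phi A *m phi B) ->
  exchange eta (la - mu) (\matrix_(i, j) phi (site_lax l eta la i j))
    (\matrix_(i, j) phi (site_lax l eta mu i j)).
Proof.
move=> phiD phiZ phiM i j k r; rewrite !mxE -!phiM -!phiZ -!phiD; congr phi.
have expand x y (X Y : 'M[C]_l.+1) : (x%:M + eta *: X) *m (y%:M + eta *: Y) =
    (x * y)%:M + (x * eta) *: Y + (y * eta) *: X + (eta ^+ 2) *: (X *m Y).
  rewrite mulmxDl !mulmxDr -scalar_mxM mul_scalar_mx mul_mx_scalar.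
  by rewrite -scalemxAl -scalemxAr !scalerA !addrA [y * eta]mulrC [eta * y]mulrC -expr2.
rewrite !site_lax_spin_mx !expand (spin_mx_comm i j k r).
move: (spin_mx k r *m spin_mx i j) (spin_mx k j *m spin_mx i r) => P Q.
move: (spin_mx i j) (spin_mx k r) (spin_mx k j) (spin_mx i r) => X1 X2 X3 X4.
apply/matrixP => u v; rewrite !mxE.
move: (P u v) (Q u v) (X1 u v) (X2 u v) (X3 u v) (X4 u v) (i == r)%:R (k == j)%:R
  (i == j)%:R (k == r)%:R => *.
by case: (u == v); rewrite ?mulr1n ?mulr0n; field.
Qed.
End SiteExchange.

(** * Polynomial dependence of matrices with operator entries *)

Section OperatorMatrices.
Variables (C : numClosedFieldType) (d : nat).
Implicit Types F G : 'M['M[C]_d]_2.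

Lemma prod_entries_scale (I : Type) (r : seq I) (F G : I -> 'M['M[C]_d]_2) (s : I -> C) p q :
  (forall i p q, F i p q = s i *: G i p q) ->
  (\prod_(i <- r) F i) p q = (\prod_(i <- r) s i) *: (\prod_(i <- r) G i) p q.
Proof.
move=> h; elim: r p q => [|i r IH] p q; first by rewrite !big_nil scale1r.
rewrite !big_cons !mxE scaler_sumr; apply: eq_bigr => k _.
by rewrite h IH -!mulmxE -scalemxAl -scalemxAr scalerA.
Qed.

Variables (T : Type) (S : (T -> C) -> Prop).
Hypothesis SR : fun_ring S.

Definition op_entries_in (F : T -> 'M['M[C]_d]_2) :=
  forall p q, entries_in S (fun t => F t p q).

Lemma op_entries_in_mul (F G : T -> 'M['M[C]_d]_2) :
  op_entries_in F -> op_entries_in G -> op_entries_in (fun t => F t *m G t).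
Proof.
move=> hF hG p q.
apply: (entries_in_ext SR (F := fun t => \sum_k F t p k *m G t k q)).
  by move=> t; rewrite mxE.
by apply: (entries_in_sum SR) => k _; apply: (entries_in_mul SR).
Qed.

Lemma op_entries_in_prod (I : Type) (r : seq I) (F : I -> T -> 'M['M[C]_d]_2) :
  (forall i, op_entries_in (F i)) ->
  op_entries_in (fun t => \prod_(i <- r) F i t).
Proof.
move=> h; elim: r => [|i r IH] p q.
  apply: (entries_in_ext SR _ (entries_in_cst SR ((1 : 'M['M[C]_d]_2) p q))) => t.
  by rewrite big_nil.
apply: (entries_in_ext SR _ (@op_entries_in_mul (F i) _ (h i) IH p q)) => t.
by rewrite big_cons.
Qed.

Lemma fused_trace_entries_in q (M : T -> 'I_q -> 'I_2 -> 'I_2 -> 'M[C]_d) :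
  (forall k p r, entries_in S (fun t => M t k p r)) ->
  entries_in S (fun t => \tr (fused_mx (M t))).
Proof.
move=> h; apply: (entries_in_sum SR) => i _.
apply: (entries_in_ext SR (F := fun t => \sum_a \sum_b
   (fusion_row C q i a * fusion_row C q i b) *:
    \prod_(k < q) M t k (aux_val a k) (aux_val b k))).
  by move=> t; rewrite fused_mxE.
apply: (entries_in_sum SR) => a _; apply: (entries_in_sum SR) => b _.
apply: (entries_in_scale SR); first exact: (fun_ring_cst SR).
by apply: (entries_in_prod SR).
Qed.
End OperatorMatrices.

Lemma fused_traceZ (C : numClosedFieldType) d q s
    (M M' : 'I_q -> 'I_2 -> 'I_2 -> 'M[C]_d) :
  (forall k p r, M k p r = s *: M' k p r) ->
  \tr (fused_mx M) = s ^+ q *: \tr (fused_mx M').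
Proof.
move=> h; rewrite /mxtrace scaler_sumr; apply: eq_bigr => i _.
rewrite !fused_mxE scaler_sumr; apply: eq_bigr => a _.
rewrite scaler_sumr; apply: eq_bigr => b _.
under eq_bigr do rewrite h.
by rewrite prodZ_mx prodr_const card_ord !scalerA mulrC.
Qed.

Lemma exprZ_mx (C : fieldType) d (c : C) (A : 'M[C]_d) k : (c *: A) ^+ k = c ^+ k *: A ^+ k.
Proof. by rewrite -[k]card_ord -!prodr_const prodZ_mx. Qed.

(** * Transfer matrices of the chain and their limits for distant inhomogeneities *)

Section Chain.
Variables (C : numClosedFieldType) (N : nat) (l : 'I_N -> nat) (eta : C).

Local Notation site n A := (@local_op C N l n A).

Lemma fused_trace_site n q (m : 'I_q -> 'I_2 -> 'I_2 -> 'M[C]_((l n).+1)) :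
  \tr (fused_mx (fun k p r => site n (m k p r))) = site n (\tr (fused_mx m)).
Proof.
rewrite /mxtrace local_op_sum; apply: eq_bigr => i _.
rewrite !fused_mxE local_op_sum; apply: eq_bigr => a _.
rewrite local_op_sum; apply: eq_bigr => b _.
by rewrite local_opZ local_op_prod.
Qed.

Lemma laxE n la p r : lax l eta n la p r = site n (site_lax (l n) eta la p r).
Proof. by rewrite mxE. Qed.

Lemma lax_shift n la c p r :
  lax l eta n (la + c) p r = (la * (p == r)%:R)%:M + lax l eta n c p r.
Proof.
rewrite !laxE -(@local_op_scalar C N l n) -local_opD; congr (local_op _).
rewrite !site_lax_spin_mx addrA -raddfD /=; congr (_%:M + _).
by ring.
Qed.

Lemma lax_exchange n la mu :
  exchange eta (la - mu) (lax l eta n la) (lax l eta n mu).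
Proof.
have h := site_lax_exchange eta la mu (@local_opD C N l n) (@local_opZ C N l n)
  (@local_opM C N l n).
by move=> i j k r; have := h i j k r; rewrite !mxE.
Qed.

Lemma lax_comm n m la mu : n != m -> entries_comm (lax l eta n la) (lax l eta m mu).
Proof. by move=> nm i j k r; rewrite !laxE local_op_comm. Qed.

Variable K : 'M[C]_2.

Lemma monodromyE xi la : monodromy l eta K xi la = scalar_entries (hdim l) K *m
  \prod_(i < N) lax l eta (rev_ord i) (la - xi ord0 (rev_ord i)).
Proof. by []. Qed.

Lemma monodromy_exchange xi la mu :
  exchange eta (la - mu) (monodromy l eta K xi la) (monodromy l eta K xi mu).
Proof.
rewrite !monodromyE; apply: exchange_mul.
- exact: exchange_scalar.
- apply: exchange_prod => [|i|i j ij]; first exact: index_enum_uniq.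
    have -> : la - mu = (la - xi ord0 (rev_ord i)) - (mu - xi ord0 (rev_ord i)) by ring.
    exact: lax_exchange.
  by apply: lax_comm; rewrite (inj_eq rev_ord_inj).
- apply: entries_comm_prod => i _; apply: entries_comm_sym; exact: entries_comm_scalar.
exact: entries_comm_scalar.
Qed.

Section Polynomial.
Variables (T : Type) (S : (T -> C) -> Prop).
Hypothesis SR : fun_ring S.

Lemma monodromy_entries_in (xi : T -> 'rV[C]_N) (la : T -> C) :
  (forall n, S (fun t => xi t 0 n)) -> S la ->
  op_entries_in S (fun t => monodromy l eta K (xi t) (la t)).
Proof.
move=> hxi hla; apply: (op_entries_in_mul SR); first by move=> p q; apply: (entries_in_cst SR).
apply: (op_entries_in_prod SR) => i p r.
have hs : S (fun t => la t - xi t 0 (rev_ord i)) by apply: (fun_ring_sub SR).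
apply: (entries_in_ext SR (F := fun t => (la t - xi t 0 (rev_ord i)) *:
   ((p == r)%:R%:M : 'M[C]_(hdim l)) + lax l eta (rev_ord i) 0 p r)).
  by move=> t; rewrite scale_scalar_mx -lax_shift addr0.
apply: (entries_in_add SR); last exact: (entries_in_cst SR).
by apply: (entries_in_scale SR) => //; apply: (entries_in_cst SR).
Qed.

Lemma transfer_entries_in (xi : T -> 'rV[C]_N) (la : T -> C) :
  (forall n, S (fun t => xi t 0 n)) -> S la ->
  entries_in S (fun t => transfer l eta K (xi t) (la t)).
Proof.
move=> hxi hla; apply: (entries_in_sum SR) => p _.
exact: (monodromy_entries_in hxi hla).
Qed.

Lemma fused_transfer_entries_in q (xi : T -> 'rV[C]_N) (la : T -> C) :
  (forall n, S (fun t => xi t 0 n)) -> S la ->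
  entries_in S (fun t => fused_transfer l eta K (xi t) q (la t)).
Proof.
move=> hxi hla.
apply: (fused_trace_entries_in SR (M := fun t (k : 'I_q) =>
   monodromy l eta K (xi t) (la t + (q - k.+1)%:R * eta))) => k p r.
apply: (monodromy_entries_in (la := fun t => la t + (q - k.+1)%:R * eta)) => //.
by apply: (fun_ring_add SR) => //; apply: (fun_ring_cst SR).
Qed.
End Polynomial.

(** The exchange relation gives commutation unless (la - mu)^2 = eta^2. The commutator is polynomial
    in la, which removes these exceptions; at la = mu the factor is -eta^2, so it does not vanish
    identically. *)
Lemma transfer_comm xi la mu : eta != 0 ->
  transfer l eta K xi la *m transfer l eta K xi mu
  = transfer l eta K xi mu *m transfer l eta K xi la.
Proof.
move=> eta0; apply/eqP; rewrite -subr_eq0; apply/eqP/matrixP => u v; rewrite [RHS]mxE.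
pose f la := (transfer l eta K xi la *m transfer l eta K xi mu
  - transfer l eta K xi mu *m transfer l eta K xi la) u v.
pose g la := (la - mu) ^+ 2 - eta ^+ 2.
have pR := poly_funR C.
have Tp : entries_in (@poly_fun C) (transfer l eta K xi).
  apply: (transfer_entries_in pR (xi := fun=> xi)) => [n|]; last exact: poly_fun_id.
  exact: (fun_ring_cst pR).
have fp : poly_fun f.
  have m1 := entries_in_mul pR Tp (entries_in_cst pR (transfer l eta K xi mu)).
  have m2 := entries_in_mul pR (entries_in_cst pR (transfer l eta K xi mu)) Tp.
  apply: (fun_ring_ext pR _ (fun_ring_sub pR (m1 u v) (m2 u v))) => t.
  by rewrite /f !mxE.
have gp : poly_fun g.
  exists (('X - mu%:P) ^+ 2 - (eta ^+ 2)%:P) => t.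
  by rewrite !hornerE.
have fg t : g t != 0 -> f t = 0.
  move=> gt; have /matrixP/(_ u v) := exchange_trace (monodromy_exchange xi t mu).
  rewrite mxE [RHS]mxE -/(transfer l eta K xi t) -/(transfer l eta K xi mu) -/(f t).
  by move/eqP; rewrite mulf_eq0 (negPf gt) => /eqP.
apply: (poly_fun_eq0 (t0 := mu) fp gp _ fg).
by rewrite /g subrr expr0n sub0r oppr_eq0 expf_neq0.
Qed.

Lemma prod_rev_ord_const (s : C) (n : 'I_N) :
  \prod_(i < N) (if rev_ord i == n then 1 else s) = s ^+ N.-1.
Proof.
rewrite -(reindex_inj rev_ord_inj (P := xpredT) (F := fun i => if i == n then 1 else s)) /=.
rewrite (bigD1 n) //= eqxx mul1r.
rewrite (eq_bigr (fun=> s)); last by move=> i /negPf ->.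
by rewrite prodr_const cardC1 card_ord.
Qed.

(* With xi = spread tau, the Lax operators of the sites i != n at
   xi_n + c are tau^-1 times scaled_lax, which is scalar at tau = 0. *)
Definition spread (tau : C) : 'rV[C]_N := \row_i (tau^-1 * i%:R).

Definition scaled_lax (n : 'I_N) (c tau : C) (i : 'I_N) : 'M[operator C l]_2 :=
  \matrix_(p, r) ((((n%:R - i%:R) * (p == r)%:R)%:M : operator C l)
    + (if i == n then 1 else tau) *: lax l eta i c p r).

Definition scaled_monodromy n c tau : 'M[operator C l]_2 :=
  scalar_entries (hdim l) K *m \prod_(i < N) scaled_lax n c tau (rev_ord i).

(** Each of the N - 1 sites other than n contributes one factor 1/tau; at site n the spectral
    parameter is c, independent of tau. *)
Lemma monodromy_spread n c tau p r : tau != 0 ->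
  monodromy l eta K (spread tau) (spread tau 0 n + c) p r
  = tau^-1 ^+ N.-1 *: scaled_monodromy n c tau p r.
Proof.
move=> tau0; rewrite monodromyE /scaled_monodromy [LHS]mxE [X in _ *: X]mxE scaler_sumr.
apply: eq_bigr => k _; rewrite -(prod_rev_ord_const _ n).
rewrite (prod_entries_scale _ (G := fun i => scaled_lax n c tau (rev_ord i))
   (s := fun i => if rev_ord i == n then 1 else tau^-1)).
  by rewrite -!mulmxE -scalemxAr.
move=> i {}p {}r; have -> : spread tau 0 n + c - spread tau ord0 (rev_ord i)
    = tau^-1 * (n%:R - (rev_ord i)%:R) + c by rewrite !mxE; ring.
rewrite lax_shift [in RHS]mxE; case: (rev_ord i =P n) => [->|_].
  by rewrite subrr mulr0 !mul0r !scale1r.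
by rewrite scalerDr scale_scalar_mx scalerA mulVf // scale1r mulrA.
Qed.

Definition spread_gap (n : 'I_N) : C :=
  \prod_(i < N) (if rev_ord i == n then 1 else n%:R - (rev_ord i)%:R).

Lemma spread_gap_neq0 n : spread_gap n != 0.
Proof.
apply/prodf_neq0 => i _; case: (rev_ord i =P n) => [_|ne]; first by rewrite oner_eq0.
by rewrite subr_eq0 eqr_nat; apply/eqP => e; apply: ne; apply/esym/val_inj.
Qed.

(** At tau = 0 every site i <> n acts by the scalar n - i, and only the twisted Lax operator of site
    n survives. *)
Lemma scaled_monodromy0 n c p r : scaled_monodromy n c 0 p r =
  spread_gap n *: site n (\sum_q K p q *: site_lax (l n) eta c q r).
Proof.
rewrite /scaled_monodromy mxE local_op_sum scaler_sumr; apply: eq_bigr => k _.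
rewrite (prod_entries_scale _ (G := fun i => if rev_ord i == n then lax l eta n c else 1)
   (s := fun i => if rev_ord i == n then 1 else n%:R - (rev_ord i)%:R)).
  have -> : \prod_(i < N) (if rev_ord i == n then lax l eta n c else 1) = lax l eta n c.
    rewrite -big_mkcond; apply: (big_pred1 (rev_ord n)) => i.
    by rewrite /= -(inj_eq rev_ord_inj i) rev_ordK.
  rewrite local_opZ -laxE mxE -mulmxE -scalemxAr mul_scalar_mx.
  by congr (_ *: _).
move=> i {}p {}r; rewrite mxE; case: (rev_ord i =P n) => [->|_].
  by rewrite subrr mul0r raddf0 add0r.
by rewrite scale0r addr0 -scale_scalar_mx mxE; congr (_ *: _); case: (p == r); rewrite ?raddf0.
Qed.

Lemma scaled_monodromy_poly n c :
  op_entries_in (@poly_fun C) (scaled_monodromy n c).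
Proof.
have pR := poly_funR C.
apply: (op_entries_in_mul pR); first by move=> p q; apply: (entries_in_cst pR).
apply: (op_entries_in_prod pR) => i p r.
apply: (entries_in_ext pR (F := fun tau =>
   (((n%:R - (rev_ord i)%:R) * (p == r)%:R)%:M : operator C l)
    + (if rev_ord i == n then 1 else tau) *: lax l eta (rev_ord i) c p r)).
  by move=> t; rewrite [RHS]mxE.
apply: (entries_in_add pR); first exact: (entries_in_cst pR).
apply: (entries_in_scale pR); last exact: (entries_in_cst pR).
by case: (rev_ord i =P n) => _; [exact: (fun_ring_cst pR)|exact: poly_fun_id].
Qed.

Hypothesis l0 : forall n, (0 < l n)%N.

Definition fusion_shift (n : 'I_N) (k : nat) : C := eta * ((l n)%:R / 2 - 2^-1 - k%:R).

Definition scaled_fused_transfer n tau : operator C l :=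
  \tr (fused_mx (fun k : 'I_(l n) => scaled_monodromy n (fusion_shift n k) tau)).

Lemma fused_transfer_spread n tau : tau != 0 ->
  fused_transfer l eta K (spread tau) (l n) (shifted_xi l eta (spread tau) n (l n).-1)
  = (tau^-1 ^+ N.-1) ^+ l n *: scaled_fused_transfer n tau.
Proof.
move=> tau0; apply: (fused_traceZ (M := fun k : 'I_(l n) =>
   monodromy l eta K (spread tau) (shifted_xi l eta (spread tau) n (l n).-1
     + (l n - k.+1)%:R * eta))) => k p r.
rewrite -monodromy_spread //; congr (monodromy _ _ _ _ _ _ _).
rewrite /shifted_xi /fusion_shift -addrA -addrA; congr (_ + _).
(* Positivity of [l n] lets [(l n).-1] be read as l - 1; both offsets then equal eta (l/2 - 1/2 -
   k). *)
rewrite natrB //; have -> : (l n)%:R = (l n).-1%:R + 1 :> C by rewrite natr1 prednK.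
by rewrite -natr1; field.
Qed.

Lemma scaled_fused_transfer0 n : K \in unitmx -> scaled_fused_transfer n 0 =
  (spread_gap n ^+ l n * ((l n)`!%:R * eta ^+ l n)) *: site n (fused_twist (l n) K).
Proof.
move=> uK; rewrite -scalerA -local_opZ -fused_trace_fusion_lax // -fused_trace_site.
apply: fused_traceZ => k p r; exact: scaled_monodromy0.
Qed.

Lemma scaled_fused_transfer_poly n :
  entries_in (@poly_fun C) (scaled_fused_transfer n).
Proof.
apply: (fused_trace_entries_in (poly_funR C) (M := fun tau (k : 'I_(l n)) =>
  scaled_monodromy n (fusion_shift n k) tau)) => k p r.
exact: scaled_monodromy_poly.
Qed.

Definition scaled_transfer n tau : operator C l := \tr (scaled_monodromy n 0 tau).

Lemma transfer_spread n tau : tau != 0 ->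
  transfer l eta K (spread tau) (spread tau 0 n)
  = tau^-1 ^+ N.-1 *: scaled_transfer n tau.
Proof.
move=> tau0; rewrite /transfer /scaled_transfer /mxtrace scaler_sumr.
by apply: eq_bigr => p _; rewrite -monodromy_spread // addr0.
Qed.

Lemma scaled_transfer0 n : scaled_transfer n 0 =
  spread_gap n *: site n (((eta / 2 - eta * (l n)%:R / 2) * \tr K)%:M + eta *: spin_rep (l n) K).
Proof.
have := trace_site_lax (l n) eta K 0; rewrite add0r => <-.
rewrite exchange_big local_op_sum scaler_sumr; apply: eq_bigr => p _.
by rewrite scaled_monodromy0.
Qed.

Lemma scaled_transfer_poly n : entries_in (@poly_fun C) (scaled_transfer n).
Proof.
apply: (entries_in_sum (poly_funR C)) => p _; exact: scaled_monodromy_poly.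
Qed.
End Chain.

(** * Bases as invertible matrices, and separating linear combinations *)

Section Bases.
Variable C : numClosedFieldType.

Lemma is_cobasisP (I : finType) m (v : I -> 'rV[C]_m) (f : 'I_m -> I) :
  bijective f -> is_cobasis v <-> \matrix_k v (f k) \in unitmx.
Proof.
move=> fb; pose W := \matrix_k v (f k); pose X := [tuple row k W | k < m].
have pX : perm_eq [seq v i | i : I] X.
  have -> : tval X = map v (map f (enum 'I_m)).
    by rewrite /= -map_comp; apply: eq_map => k; rewrite rowK.
  rewrite /image_mem; apply: perm_map; apply: uniq_perm; first exact: enum_uniq.
    by rewrite map_inj_uniq ?enum_uniq //; exact: bij_inj.
  case: fb => g fK gK i; rewrite mem_enum; apply/esym/mapP.
  by exists (g i); rewrite ?mem_enum ?gK.
rewrite /is_cobasis (perm_basis _ pX) basisEfree subvf size_tuple dimvf /dim /= mul1n leqnn.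
rewrite andbT /=.
split=> [/(@freeP _ _ _ X) fX | uW].
  rewrite unitmxE unitfE; apply/det0P => -[u u0 uW].
  case/eqP: u0; apply/rowP => k; rewrite [RHS]mxE.
  suff s : \sum_(i < m) u 0 i *: X`_i = 0 by exact: (fX (u 0) s k).
  rewrite -[RHS]uW mulmx_sum_row; apply: eq_bigr => i _.
  by rewrite -tnth_nth tnth_mktuple.
apply/(@freeP _ _ _ X) => k e i; have : \row_i k i = 0.
  apply: (can_inj (mulmxK uW)); rewrite mul0mx -[RHS]e mulmx_sum_row.
  by apply: eq_bigr => j _; rewrite mxE -tnth_nth tnth_mktuple.
by move/rowP/(_ i); rewrite !mxE.
Qed.

Lemma det_scale_rows m (s : 'I_m -> C) (r : 'I_m -> 'rV[C]_m) :
  \det (\matrix_k (s k *: r k)) = (\prod_k s k) * \det (\matrix_k r k).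
Proof.
have -> : \matrix_k (s k *: r k) = diag_mx (\row_k s k) *m \matrix_k r k.
  by apply/row_matrixP => k; rewrite row_mul row_diag_mx -scalemxAl -rowE !rowK mxE.
rewrite det_mulmx det_diag; congr (_ * _); apply: eq_bigr => k _; exact: mxE.
Qed.

(** For each pair a <> b the difference of the sums is a nonzero polynomial in s; any non-root of
    the product over all pairs will do. *)
Lemma separating_combination (I : finType) N (e : I -> 'I_N -> C) :
  (forall a b, a != b -> exists n, e a n != e b n) ->
  exists s, injective (fun a => \sum_(n < N) s ^+ n * e a n).
Proof.
move=> h.
(* [insub] turns a coefficient index k < N back into an element of ['I_N], so the default 0 is never
   reached. *)
pose g (ab : I * I) : {poly C} := \poly_(k < N)
  (if insub k is Some n then e ab.1 n - e ab.2 n else 0).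
have g_coef ab (n : 'I_N) : (g ab)`_n = e ab.1 n - e ab.2 n.
  by rewrite coef_poly ltn_ord valK.
have : \prod_(ab | ab.1 != ab.2) g ab != 0.
  apply/prodf_neq0 => ab /h[n]; apply: contraNneq => g0.
  by rewrite -subr_eq0 -g_coef g0 coef0.
case/closed_nonrootP => s; rewrite /root horner_prod => /prodf_neq0 gs.
exists s => a b /eqP; rewrite -subr_eq0 => eab; apply/eqP.
apply: contraTT eab => ab; have := gs (a, b) ab; congr (_ != 0).
rewrite horner_poly -sumrB; apply: eq_bigr => n _.
by rewrite valK /= mulrC mulrBr.
Qed.
End Bases.

(** * The covector basis and simplicity of the transfer matrix *)

Section SeparationOfVariables.
Variables (C : numClosedFieldType) (N : nat) (l : 'I_N -> nat) (eta : C).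
Variable K : 'M[C]_2.
Hypotheses (eta0 : eta != 0) (l0 : forall n, (0 < l n)%N).

Definition sov_mx xi Omega : 'M[C]_(hdim l) :=
  \matrix_k sov_covector eta K xi Omega (conf_val k).

Lemma is_cobasis_sov xi Omega :
  \det (sov_mx xi Omega) != 0 -> is_cobasis (sov_covector eta K xi Omega).
Proof.
rewrite -unitfE -unitmxE => u.
exact/(is_cobasisP _ (@enum_val_bij (conf l))).
Qed.

Lemma det_sov_mx_in T (S : (T -> C) -> Prop) (xi : T -> 'rV[C]_N)
    (Omega : T -> 'rV[C]_(hdim l)) : fun_ring S ->
  (forall n, S (fun t => xi t 0 n)) -> entries_in S Omega ->
  S (fun t => \det (sov_mx (xi t) (Omega t))).
Proof.
move=> SR hxi hO; apply: (fun_ring_det SR) => i j.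
apply: (fun_ring_ext SR (f := fun t => sov_covector eta K (xi t) (Omega t) (conf_val i) 0 j)).
  by move=> t; rewrite [RHS]mxE.
move: (0 : 'I_1) j; apply: (entries_in_mul SR) => //.
apply: (entries_in_prod SR) => n _; apply: (entries_in_exp SR).
apply: (fused_transfer_entries_in eta K SR) => //.
do 2![apply: (fun_ring_add SR); last exact: (fun_ring_cst SR)].
exact: hxi.
Qed.

Definition scaled_sov_mx (w : forall n, 'rV[C]_((l n).+1)) tau : 'M[C]_(hdim l) :=
  \matrix_k (tensor_covector w *m
    \prod_(n < N) scaled_fused_transfer l eta K n tau ^+ conf_val k n).

Lemma prod_scaled_exp (s : 'I_N -> C) (A : 'I_N -> operator C l) (h : conf l) :
  \prod_n (s n *: A n) ^+ h n = (\prod_n s n ^+ h n) *: \prod_n A n ^+ h n.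
Proof. by under eq_bigr do rewrite exprZ_mx; rewrite prodZ_mx. Qed.

(** At tau = 0 each row is a nonzero multiple of a row of the tensor product of the local basis
    matrices [W n], which is invertible factor by factor. *)
Lemma scaled_sov_mx0 w : K \in unitmx ->
  (forall n, is_cobasis (fun h : 'I_(l n).+1 => w n *m fused_twist (l n) K ^+ h)) ->
  \det (scaled_sov_mx w 0) != 0.
Proof.
move=> uK wb.
pose W n := \matrix_(h < (l n).+1) (w n *m fused_twist (l n) K ^+ h).
pose s n := spread_gap C n ^+ l n * ((l n)`!%:R * eta ^+ l n).
have uW n : W n \in unitmx.
  have idb : bijective (@id 'I_(l n).+1) by exists id.
  have [h _] := is_cobasisP (fun h : 'I_(l n).+1 => w n *m fused_twist (l n) K ^+ h) idb.
  exact: h (wb n).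
have -> : scaled_sov_mx w 0 = \matrix_k ((\prod_n s n ^+ conf_val k n) *:
    row k (tensor_op W)).
  apply/row_matrixP => k; rewrite !rowK rowE.
  rewrite (eq_bigr _ (fun n _ => congr1 (fun X : operator C l => X ^+ conf_val k n)
    (scaled_fused_transfer0 l eta n uK))).
  rewrite prod_scaled_exp -scalemxAr; congr (_ *: _).
  rewrite (eq_bigr _ (fun n _ => esym (local_op_exp (fused_twist (l n) K) (conf_val k n)))).
  rewrite -/(tensor_op (fun n => fused_twist (l n) K ^+ conf_val k n)) tensor_covector_op.
  rewrite -[k in delta_mx 0 k]enum_valK -tensor_delta_covectors tensor_covector_op.
  by apply: eq_tensor_covector => n; rewrite /delta_covectors -rowE rowK.
rewrite det_scale_rows mulf_neq0 //.
  apply/prodf_neq0 => k _; apply/prodf_neq0 => n _; apply: expf_neq0.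
  rewrite /s !mulf_neq0 ?expf_neq0 ?spread_gap_neq0 //.
  by rewrite pnatr_eq0 -lt0n fact_gt0.
rewrite (_ : \matrix_k _ = tensor_op W) -?unitfE -?unitmxE ?tensor_op_unit //.
by apply/row_matrixP => k; rewrite rowK.
Qed.

Lemma exists_spread_sov w : K \in unitmx ->
  (forall n, is_cobasis (fun h : 'I_(l n).+1 => w n *m fused_twist (l n) K ^+ h)) ->
  exists tau, \det (sov_mx (spread N tau) (tensor_covector w)) != 0.
Proof.
move=> uK wb.
have fp : poly_fun (fun tau => \det (scaled_sov_mx w tau)).
  have pR := poly_funR C; apply: (fun_ring_det pR) => i j.
  apply: (fun_ring_ext pR (f := fun tau => (tensor_covector w *m
    \prod_(n < N) scaled_fused_transfer l eta K n tau ^+ conf_val i n) 0 j)).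
    by move=> t; rewrite [RHS]mxE.
  move: (0 : 'I_1) j; apply: (entries_in_mul pR); first exact: (entries_in_cst pR).
  apply: (entries_in_prod pR) => n _; apply: (entries_in_exp pR).
  exact: scaled_fused_transfer_poly.
have [tau tau0 ftau] := poly_fun_neq0 fp (scaled_sov_mx0 uK wb).
exists tau.
(* Each row differs from the rescaled one by a power of 1/tau, so the two determinants differ by a
   nonzero factor. *)
have -> : sov_mx (spread N tau) (tensor_covector w) =
  \matrix_k ((\prod_n ((tau^-1 ^+ N.-1) ^+ l n) ^+ conf_val k n) *: row k (scaled_sov_mx w tau)).
  apply/row_matrixP => k; rewrite !rowK /sov_covector.
  rewrite [RHS]scalemxAr -prod_scaled_exp; congr (_ *m _); apply: eq_bigr => n _.
  congr (_ ^+ _); exact: (fused_transfer_spread eta K l0 n tau0).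
rewrite det_scale_rows mulf_neq0 //.
  apply/prodf_neq0 => k _; apply/prodf_neq0 => n _.
  by rewrite !expf_neq0 // invr_eq0.
rewrite (_ : \matrix_k _ = scaled_sov_mx w tau) //.
by apply/row_matrixP => k; rewrite rowK.
Qed.

(** The covector with all coordinates 1 in the eigenbasis is cyclic: its images under the powers of
    [A] form a Vandermonde matrix in the distinct eigenvalues. *)
Lemma exists_cyclic_covector q (A F : 'M[C]_q.+1) d : F \in unitmx ->
  A *m F = F *m diag_mx d -> injective (d 0) ->
  is_cobasis (fun h : 'I_q.+1 => (const_mx 1 *m invmx F) *m A ^+ h).
Proof.
move=> uF AF dI; have idb : bijective (@id 'I_q.+1) by exists id.
apply/(is_cobasisP _ idb).
have -> : \matrix_(h < q.+1) ((const_mx 1 *m invmx F) *m A ^+ h) = Vandermonde q.+1 d *m invmx F.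
  apply/row_matrixP => h; rewrite rowK row_mul.
  have -> : row h (Vandermonde q.+1 d) = const_mx 1 *m diag_mx (\row_i d 0 i ^+ h).
    by apply/rowP => i; rewrite mul_mx_diag !mxE mul1r.
  rewrite -!mulmxA; congr (_ *m _); apply: (can_inj (mulmxK uF)).
  by rewrite -!mulmxA (diag_conj_exp h AF) mulVmx // mulmx1 mulKmx.
rewrite unitmx_mul unitmx_inv uF andbT unitmxE unitfE det_Vandermonde.
apply/prodf_neq0 => i _; apply/prodf_neq0 => j ij.
by rewrite subr_eq0; apply: contraTneq ij => /dI ->; rewrite ltnn.
Qed.

Variables (G : 'M[C]_2) (kappa : 'rV[C]_2).
Hypotheses (uG : G \in unitmx) (KG : K *m G = G *m diag_mx kappa).

Lemma fused_twist_diag_conj q :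
  fused_twist q K *m fused_twist q G = fused_twist q G *m
    diag_mx (\row_i (kappa 0 0 ^+ (q - i) * kappa 0 1 ^+ i)).
Proof. by rewrite -fused_twistM KG fused_twistM fused_twist_diag. Qed.

Hypothesis kappa_neq : kappa 0 0 != kappa 0 1.

(** The eigenvalue of [scaled_transfer] at tau = 0 on the i-th eigenvector of site n, with
    [spread_gap] removed. *)
Definition site_eigenvalue (n : 'I_N) (i : nat) : C :=
  (eta / 2 - eta * (l n)%:R / 2) * \tr K
  + eta * (kappa 0 0 * (l n - i)%:R + kappa 0 1 * i%:R).

Lemma site_eigenvalue_inj n (i j : 'I_(l n).+1) :
  site_eigenvalue n i = site_eigenvalue n j -> i = j.
Proof.
have E (k : 'I_(l n).+1) : site_eigenvalue n k = (eta / 2 - eta * (l n)%:R / 2) * \tr K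
  + eta * kappa 0 0 * (l n)%:R + eta * (kappa 0 1 - kappa 0 0) * k%:R.
  by rewrite /site_eigenvalue natrB -1?ltnS //; ring.
rewrite !E => /addrI/mulfI => /(_ _)/eqP; rewrite eqr_nat => h.
apply/val_inj/eqP/h; rewrite mulf_neq0 // subr_eq0 eq_sym //.
Qed.

(** One product eigenbasis diagonalizes all the limits. A configuration is determined by the list of
    its site eigenvalues, which [separating_combination] merges into a single number. *)
Lemma exists_simple_combination : exists c : 'I_N -> C,
  simple_diag (\sum_n c n *: scaled_transfer l eta K n 0).
Proof.
have [s sI] : exists s : C, injective (fun a : 'I_(hdim l) =>
    \sum_(n < N) s ^+ n * site_eigenvalue n (conf_val a n)).
  apply: separating_combination => a b ab.
  have [n ne] : exists n, conf_val a n != conf_val b n.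
    apply/existsP; apply: contraNT ab; rewrite negb_exists => /forallP h.
    by apply/eqP/enum_val_inj/ffunP => n; apply/eqP; rewrite -[_ == _]negbK; exact: h.
  by exists n; apply: contraNneq ne => /site_eigenvalue_inj ->.
(* Division by [spread_gap] cancels the site-dependent factor of the limit. *)
exists (fun n : 'I_N => s ^+ n / spread_gap C n).
exists (tensor_op (fun n => fused_twist (l n) G)).
  by apply: tensor_op_unit => n; exact: fused_twist_unit.
exists (\row_a \sum_(n < N) s ^+ n * site_eigenvalue n (conf_val a n)).
  by move=> a b; rewrite !mxE; exact: sI.
pose D n : 'rV[C]_(l n).+1 := \row_i site_eigenvalue n i.
have -> : diag_mx (\row_a \sum_(n < N) s ^+ n * site_eigenvalue n (conf_val a n))
    = \sum_(n < N) s ^+ n *: @local_op C N l n (diag_mx (D n)).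
  apply/matrixP => a b; rewrite summxE !mxE -sumrMnl; apply: eq_bigr => n _.
  by rewrite local_op_diag !mxE mulrnAr.
rewrite mulmx_suml mulmx_sumr; apply: eq_bigr => n _.
rewrite scaled_transfer0 scalerA divfK ?spread_gap_neq0 //.
rewrite -scalemxAl -scalemxAr; congr (_ *: _); apply: local_op_tensor_op.
rewrite mulmxDl -scalemxAl (spin_rep_fused_twist (l n) KG) spin_rep_diag.
rewrite mul_scalar_mx -mul_mx_scalar scalemxAr -mulmxDr; congr (_ *m _).
apply/matrixP => i j; rewrite !mxE.
by case: (i == j); rewrite ?mulr1n ?mulr0n ?mulr0 ?addr0.
Qed.

(** Whatever commutes with a matrix of simple spectrum is diagonal in its eigenbasis. Two equal
    eigenvalue functions would give the combination a repeated eigenvalue. *)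
Lemma diagonalizable_simple_family_comm (T : C -> operator C l) (c : 'I_N -> C) (la : 'I_N -> C) :
  (forall x y, T x *m T y = T y *m T x) ->
  simple_diag (\sum_n c n *: T (la n)) -> diagonalizable_simple_family T.
Proof.
move=> TT [U uU [d dI XU]]; exists U => //.
pose X := \sum_n c n *: T (la n); pose Y x := invmx U *m T x *m U.
have XT x : X *m T x = T x *m X.
  rewrite mulmx_suml mulmx_sumr; apply: eq_bigr => n _.
  by rewrite -scalemxAl -scalemxAr TT.
have DU : invmx U *m X = diag_mx d *m invmx U.
  by apply: (can_inj (mulmxK uU)); rewrite -mulmxA XU mulKmx // mulmxKV.
have YD x : Y x *m diag_mx d = diag_mx d *m Y x.
  by rewrite /Y !mulmxA -DU -[in LHS]mulmxA -XU !mulmxA -(mulmxA _ (T x) X) -XT !mulmxA.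
have Ydiag x i j : i != j -> Y x i j = 0.
  move=> ij; have /matrixP/(_ i j) := YD x; rewrite mul_mx_diag mul_diag_mx !mxE.
  move/eqP; rewrite mulrC -subr_eq0 -mulrBl mulf_eq0 => /orP[|/eqP //].
  by rewrite subr_eq0 => /eqP/dI ji; rewrite ji eqxx in ij.
exists (fun i x => Y x i i); split=> [x|i j tij].
  have -> : diag_mx (\row_i Y x i i) = Y x.
    apply/matrixP => i j; rewrite [LHS]mxE [X in X *+ _]mxE.
    have [<-|ij] := eqVneq i j; first by rewrite mulr1n.
    by rewrite mulr0n Ydiag.
  by rewrite /Y -mulmxA mulKVmx.
have dE k : d 0 k = \sum_n c n * Y (la n) k k.
  have : diag_mx d = \sum_n c n *: Y (la n).
    rewrite -[LHS](mulmxKV uU) -DU /X mulmx_sumr mulmx_suml; apply: eq_bigr => n _.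
    by rewrite -scalemxAr -scalemxAl.
  move/matrixP/(_ k k); rewrite mxE eqxx mulr1n => ->.
  by rewrite summxE; apply: eq_bigr => n _; rewrite mxE.
by apply: dI; rewrite !dE; apply: eq_bigr => n _; rewrite tij.
Qed.
End SeparationOfVariables.

Lemma diag_of_simple_spectrum (C : numClosedFieldType) (K : 'M[C]_2) :
  diagonalizable K -> simple_spectrum K -> exists G : 'M[C]_2, exists kappa : 'rV[C]_2,
  [/\ G \in unitmx, K *m G = G *m diag_mx kappa & kappa 0 0 != kappa 0 1].
Proof.
case=> P uP /(similar_diagLR uP)[d KE] sK.
have uG : invmx P \in unitmx by rewrite unitmx_inv.
have KG : K *m invmx P = invmx P *m diag_mx d by rewrite KE conjVmx // mulmxK.
exists (invmx P), d; split=> //.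
by apply/eqP => /(simple_spectrum_diag uG KG sK).
Qed.

Theorem proposition4p1 (R : realType) (eta : R[i]) (N : nat)
    (l : 'I_N -> nat) (K : 'M[R[i]]_2) :
  eta != 0 -> (0 < N)%N -> (forall n, (0 < l n)%N) ->
  diagonalizable K -> simple_spectrum K -> K \in unitmx ->
  [/\ (forall n, simple_spectrum (fused_twist (l n) K)) ->
      almost_all (fun x : 'rV[R[i]]_(hdim l + N) =>
        let Omega := lsubmx x in let xi := rsubmx x in
        distinct_mod_eta eta xi ->
        is_cobasis (sov_covector eta K xi Omega)),
      forall w : forall n : 'I_N, 'rV[R[i]]_((l n).+1),
        (forall n, is_cobasis
           (fun h : 'I_(l n).+1 => w n *m fused_twist (l n) K ^+ h)) ->
        almost_all (fun xi : 'rV[R[i]]_N =>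
          distinct_mod_eta eta xi ->
          is_cobasis (sov_covector eta K xi (tensor_covector w)))
    & almost_all (fun xi : 'rV[R[i]]_N =>
        distinct_mod_eta eta xi ->
        diagonalizable_simple_family
          (transfer l eta K xi))].
Proof.
move=> eta0 _ l0 dK sK uK.
have [G [kappa [uG KG kappa_neq]]] := diag_of_simple_spectrum dK sK.
have mR n := mpoly_funR R[i] n.
split.
- move=> sF.
  (* A point with nonzero determinant is needed: simplicity of the fused twists supplies cyclic
     local covectors, and their product is the witness for Omega. *)
  pose w n := const_mx 1 *m invmx (fused_twist (l n) G) : 'rV[R[i]]_(l n).+1.
  have wb n : is_cobasis (fun h : 'I_(l n).+1 => w n *m fused_twist (l n) K ^+ h).
    have uF := fused_twist_unit (l n) uG; have FG := fused_twist_diag_conj KG (l n).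
    exact: exists_cyclic_covector uF FG (simple_spectrum_diag uF FG (sF n)).
  have [tau dtau] := exists_spread_sov eta0 l0 uK wb.
  pose f (x : 'rV[R[i]]_(hdim l + N)) := \det (sov_mx eta K (rsubmx x) (lsubmx x)).
  apply: (almost_all_neq0 (f := f) (x0 := row_mx (tensor_covector w) (spread N tau))).
  + apply: det_sov_mx_in => // [n|i j].
      apply: (fun_ring_ext (mR _) (f := fun x => x 0 (rshift (hdim l) n))) => [x|].
        by rewrite mxE.
      exact: mpoly_fun_coord.
    apply: (fun_ring_ext (mR _) (f := fun x => x 0 (lshift N j))) => [x|].
      by rewrite mxE (ord1 i).
    exact: mpoly_fun_coord.
  + by rewrite /f row_mxKl row_mxKr.
  by move=> x fx /= _; apply: is_cobasis_sov.
- move=> w wb; have [tau dtau] := exists_spread_sov eta0 l0 uK wb.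
  apply: (almost_all_neq0 (f := fun xi => \det (sov_mx eta K xi (tensor_covector w)))
    (x0 := spread N tau)) => //.
    apply: det_sov_mx_in => // [n|]; first exact: mpoly_fun_coord.
    exact: (entries_in_cst (mR _)).
  by move=> xi dxi _; apply: is_cobasis_sov.
have [c Xc] := exists_simple_combination l eta0 uG KG kappa_neq.
have pR := poly_funR R[i].
have fp : poly_fun (fun tau => disc (\sum_n c n *: scaled_transfer l eta K n tau)).
  apply: (fun_ring_disc pR); apply: (entries_in_sum pR) => n _.
  apply: (entries_in_scale pR); [exact: (fun_ring_cst pR)|exact: scaled_transfer_poly].
have [tau tau0 dtau] := poly_fun_neq0 fp (proj2 (disc_neq0 _) Xc).
(* Taking the spectral parameter at xi_n makes [X] polynomial in the inhomogeneities alone, and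
   [disc] turns its simplicity into one polynomial condition. *)
pose X xi := \sum_n c n *: transfer l eta K xi (xi 0 n).
apply: (almost_all_neq0 (f := fun xi => disc (X xi)) (x0 := spread N tau)).
- apply: (fun_ring_disc (mR _)); apply: (entries_in_sum (mR _)) => n _.
  apply: (entries_in_scale (mR _)); first exact: (fun_ring_cst (mR _)).
  by apply: (transfer_entries_in eta K (mR _)) => [m|]; exact: mpoly_fun_coord.
- apply/disc_neq0.
  have -> : X (spread N tau) = tau^-1 ^+ N.-1 *: \sum_n c n *: scaled_transfer l eta K n tau.
    rewrite scaler_sumr; apply: eq_bigr => n _.
    by rewrite transfer_spread // !scalerA mulrC.
  by apply: simple_diagZ; [rewrite expf_neq0 ?invr_eq0|apply/disc_neq0].
move=> xi /disc_neq0 Xxi _.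
apply: (diagonalizable_simple_family_comm (la := fun n => xi 0 n)) Xxi => x y.
exact: transfer_comm.
Qed.
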